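(* For every fixed constant $K$, MAXSPACE-RD restricted to instances with $K$ slots admits a polynomial-time approximation scheme: for every constant $\varepsilon'>0$ there is a polynomial-time algorithm that outputs a feasible schedule whose fullness is at least $(1-\varepsilon')$ times the maximum fullness of a feasible schedule.
   Context: MAXSPACE-RD: given $K$ slots $B_1,\dots,B_K$, each of size $L=1$, and a set of ads $\mathcal{A}=\{A_1,\dots,A_n\}$, where each ad $A_i$ has a size $0<s_i\le 1$, a frequency $w_i$, a release date $r_i\ge 1$ and a deadline $d_i\le K$ with $d_i-r_i+1\ge w_i$. A feasible schedule chooses a subset $\mathcal{A}'\subseteq\mathcal{A}$ and assigns each $A_i\in\mathcal{A}'$ to exactly $w_i$ distinct slots $B_j$ with $r_i\le j\le d_i$ (at most one copy per slot), such that for every slot $\sum_{A_i\in B_j}s_i\le 1$. The fullness of the schedule is $\sum_{A_i\in\mathcal{A}'}s_iw_i$, to be maximized. *)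

(* Defs.v *)
From mathcomp Require Import all_boot all_order all_algebra.
From mathcomp Require Import reals.

Set Implicit Arguments.
Unset Strict Implicit.
Unset Printing Implicit Defensive.

Import Order.TTheory GRing.Theory Num.Theory.

(** * MAXSPACE-RD *)

(* The sizes are rational because they are part of the input of an algorithm,
   where they are written in binary. *)
Record ad := Ad {
  ad_size : rat;
  ad_freq : nat;
  ad_release : nat;
  ad_deadline : nat
}.

(* [w <= d - r + 1] is written without subtraction because that of [nat] is
   truncated. *)
Definition valid_ad (K : nat) (a : ad) : bool :=
  [&& (0 < ad_size a)%R, (ad_size a <= 1)%R, 1 <= ad_release a,
      ad_deadline a <= K & ad_release a + ad_freq a <= (ad_deadline a).+1].

Definition valid_instance (K n : nat) (A : n.-tuple ad) : bool :=
  [forall i : 'I_n, valid_ad K (tnth A i)].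

(* [S i = None] if the ad [i] is not in the chosen subset, and [S i = Some B]
   if it is chosen and has one copy in each slot of [B].  The element [j] of
   ['I_K] stands for the slot number [j.+1]. *)
Definition schedule (K n : nat) := {ffun 'I_n -> option {set 'I_K}}.

Definition chosen (K n : nat) (S : schedule K n) : {set 'I_n} :=
  [set i | S i != None].

Definition slots (K n : nat) (S : schedule K n) (i : 'I_n) : {set 'I_K} :=
  odflt set0 (S i).

Definition feasible (K n : nat) (A : n.-tuple ad) (S : schedule K n) : bool :=
  [forall i in chosen S,
     (#|slots S i| == ad_freq (tnth A i)) &&
     [forall j in slots S i,
        ad_release (tnth A i) <= j.+1 <= ad_deadline (tnth A i)]] &&
  [forall j : 'I_K,
     (\sum_(i in chosen S | j \in slots S i) ad_size (tnth A i) <= 1)%R].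

Definition fullness (K n : nat) (A : n.-tuple ad) (S : schedule K n) : rat :=
  (\sum_(i in chosen S) ad_size (tnth A i) * (ad_freq (tnth A i))%:R)%R.

(* The default value [0] of the maximum is the fullness of the empty schedule,
   which is feasible. *)
Definition max_fullness (K n : nat) (A : n.-tuple ad) : rat :=
  \big[Num.max/0%R]_(S : schedule K n | feasible A S) fullness A S.

(** * Algorithms and their running time *)

(* Programs transform binary trees whose leaves are natural numbers.  The cost
   is logarithmic: an elementary operation costs the number of bits of its
   argument and of its result.  Hence a run of cost [t] only handles data of
   size at most [t] (see [runs_size]), and polynomial time in this model is
   polynomial time on Turing machines or on random access machines with
   logarithmic cost. *)
Inductive value := Num of nat | Pair of value & value.

Definition bit_length (n : nat) : nat := (trunc_log 2 n).+1.

Fixpoint vsize (v : value) : nat :=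
  match v with
  | Num n => bit_length n
  | Pair u w => (vsize u + vsize w).+1
  end.

Inductive arith_op := Add | Sub | Mul | Div.

Definition arith_eval (o : arith_op) : nat -> nat -> nat :=
  match o with
  | Add => addn
  | Sub => subn
  | Mul => muln
  | Div => divn
  end.

Inductive prim := Id | Const of value | Fst | Snd | Arith of arith_op.

Definition prim_eval (f : prim) (x : value) : option value :=
  match f, x with
  | Id, _ => Some x
  | Const v, _ => Some v
  | Fst, Pair u _ => Some u
  | Snd, Pair _ w => Some w
  | Arith o, Pair (Num a) (Num b) => Some (Num (arith_eval o a b))
  | _, _ => None
  end.

(* [Num 0] is false and every other value is true. *)
Definition truthy (v : value) : bool := if v is Num 0 then false else true.

Inductive prog :=
  | Prim of prim
  | Seq of prog & prog
  | Fork of prog & prog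
  | If of prog & prog & prog
  | While of prog & prog.

(* [runs p x y t]: on the input [x], the program [p] halts with the output [y]
   at the cost [t].  [Seq p q] runs [p] first; [Fork p q] runs both programs on
   the same input and pairs their outputs. *)
Inductive runs : prog -> value -> value -> nat -> Prop :=
  | RunPrim f x y :
      prim_eval f x = Some y -> runs (Prim f) x y (vsize x + vsize y)
  | RunSeq p q x y z s t :
      runs p x y s -> runs q y z t -> runs (Seq p q) x z (s + t)
  | RunFork p q x y z s t :
      runs p x y s -> runs q x z t -> runs (Fork p q) x (Pair y z) (s + t).+1
  | RunIf b p q x v y s t :
      runs b x v s -> runs (if truthy v then p else q) x y t ->
      runs (If b p q) x y (s + t)
  | RunWhileStop b p x v s :
      runs b x v s -> ~~ truthy v -> runs (While b p) x x (s + vsize x)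
  | RunWhileStep b p x v y z s t u :
      runs b x v s -> truthy v -> runs p x y t -> runs (While b p) y z u ->
      runs (While b p) x z (s + t + u).

Lemma runs_size p x y t : runs p x y t -> vsize x + vsize y <= t.
Proof.
elim=> {p x y t} //=.
- move=> p q x y z s t _ Hp _ Hq.
  apply: leq_add; first exact: leq_trans (leq_addr _ _) Hp.
  exact: leq_trans (leq_addl _ _) Hq.
- move=> p q x y z s t _ Hp _ Hq; rewrite addnS ltnS addnA.
  by apply: leq_add => //; apply: leq_trans (leq_addl _ _) Hq.
- by move=> b p q x v y s t _ _ _ H; apply: leq_trans H (leq_addl _ _).
- move=> b p x v s _ H _; rewrite leq_add2r.
  exact: leq_trans (leq_addr _ _) H.
- move=> b p x v y z s t u _ _ _ _ Hp _ Hw; apply: leq_add.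
    exact: leq_trans (leq_trans (leq_addr _ _) Hp) (leq_addl _ _).
  exact: leq_trans (leq_addl _ _) Hw.
Qed.

Lemma runs_det p x y t y' t' :
  runs p x y t -> runs p x y' t' -> y = y' /\ t = t'.
Proof.
move=> H; elim: H y' t' => {p x y t} [f x y E|p q x y z s t _ IHp _ IHq
  |p q x y z s t _ IHp _ IHq|b p q x v y s t _ IHb _ IHp
  |b p x v s _ IHb Hv|b p x v y z s t u _ IHb Hv _ IHp _ IHw] y' t' H;
  inversion H; subst;
  repeat match goal with
  | IH : forall y t, runs ?p ?x y t -> _, K : runs ?p ?x _ _ |- _ =>
      case: (IH _ _ K) => ? ?; subst; clear K
  end; try by [].
- by have -> : y = y' by congruence.
- match goal with K : is_true (truthy _) |- _ => by rewrite K in Hv end.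
- match goal with K : is_true (~~ _) |- _ => by rewrite Hv in K end.
Qed.

Fixpoint encode_list (s : seq value) : value :=
  if s is v :: s' then Pair v (encode_list s') else Num 0.

(* The size is given by its numerator and denominator in lowest terms; the
   numerator is positive in a valid instance. *)
Definition encode_ad (a : ad) : value :=
  encode_list [:: Num `|numq (ad_size a)|; Num `|denq (ad_size a)|;
                  Num (ad_freq a); Num (ad_release a); Num (ad_deadline a)].

Definition encode_instance (n : nat) (A : n.-tuple ad) : value :=
  encode_list [seq encode_ad a | a <- A].

(* One entry per ad: [Num 0] if it is not chosen, and otherwise [Num 1] paired
   with the increasing list of the numbers of its slots. *)
Definition encode_schedule (K n : nat) (S : schedule K n) : value :=
  encode_list
    [seq if S i is Some B
         then Pair (Num 1) (encode_list [seq Num j.+1 | j : 'I_K <- enum B])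
         else Num 0
    | i <- enum 'I_n].

(* The program may depend on [K] and [rho], but not on the instance. *)
Definition polytime_approximable (R : realType) (K : nat) (rho : R) : Prop :=
  exists (p : prog) (c d : nat),
    forall (n : nat) (A : n.-tuple ad), valid_instance K A ->
      exists (S : schedule K n) (t : nat),
        [/\ runs p (encode_instance A) (encode_schedule S) t,
            t <= c * vsize (encode_instance A) ^ d + c,
            feasible A S &
            (rho * ratr (max_fullness K A) <= ratr (fullness A S))%R].

(* Main.v *)
(* Multiplying all sizes by the product [D] of their denominators makes them
   integers.  Since [K] is fixed, there is only a constant number of keys
   (frequency, release date, deadline), hence of pairs (key, set of slots).
   Fix an optimal schedule, of value [V], and let [thr] be the least size such
   that at most [h] chosen ads of positive frequency are larger; then
   [h * thr <= V].  Keep the large ads where they are, and repack the small ads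
   of every key greedily: in input order, fill each set of slots [B] up to the
   total size that it has in the optimal schedule, then go on with the next one.
   No slot gets more than before, and each pair (key, set of slots) loses at most
   [K * thr], so for [h] of order [1 / eps] the loss is at most [eps * V].  The
   result is described by a constant number of rules, one per large ad and one
   interval of indices per pair, with thresholds among the sizes in the input;
   the algorithm tries all such lists of rules and keeps the best feasible one. *)
Require Import Defs.
From mathcomp Require Import all_boot all_order all_algebra.
From mathcomp Require Import reals boolp.
From mathcomp Require Import zify.

Set Implicit Arguments.
Unset Strict Implicit.
Unset Printing Implicit Defensive.



(** * Polynomial-time functions on encoded types *)

(** The encoding is inferred from the type, so that polynomial time can be stated for ordinary
    functions and programs are written out only for a few primitives. *)
Class Enc (X : Type) := enc : X -> value.

Instance enc_nat : Enc nat := Defs.Num.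
Instance enc_bool : Enc bool := fun b : bool => Defs.Num b.
Instance enc_pair X Y (EX : Enc X) (EY : Enc Y) : Enc (X * Y) :=
  fun p => Pair (enc p.1) (enc p.2).
Instance enc_seq X (EX : Enc X) : Enc (seq X) := fun s => encode_list (map enc s).
Instance enc_option X (EX : Enc X) : Enc (option X) :=
  fun o => if o is Some x then Pair (Defs.Num 1) (enc x) else Defs.Num 0.

Definition sz {X} {EX : Enc X} (x : X) : nat := vsize (enc x).

Lemma vsize_gt0 v : 0 < vsize v. Proof. by case: v. Qed.

Lemma sz_pair X Y (EX : Enc X) (EY : Enc Y) (x : X) (y : Y) :
  sz (x, y) = (sz x + sz y).+1.
Proof. by []. Qed.

Lemma sz_cons X (EX : Enc X) (x : X) (s : seq X) : sz (x :: s) = (sz x + sz s).+1.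
Proof. by []. Qed.

(** * Polynomial bounds in the size of the input *)

Section PolyBound.
Context {X : Type} {EX : Enc X}.

(** The base is visibly positive, so a larger exponent never lowers the bound and two bounds can be
    merged by adding exponents. *)
Definition pbnd (g : X -> nat) : Prop :=
  exists c d, forall x, g x <= c * (sz x).+1 ^ d.

Lemma pbnd_le (g g' : X -> nat) : (forall x, g x <= g' x) -> pbnd g' -> pbnd g.
Proof. by move=> le [c [d H]]; exists c, d => x; apply: leq_trans (le x) (H x). Qed.

Lemma pbnd_const k : pbnd (fun=> k).
Proof. by exists k, 0 => x; rewrite expn0 muln1. Qed.

Lemma pbnd_sz : pbnd sz.
Proof. by exists 1, 1 => x; rewrite expn1 mul1n. Qed.

Lemma pbnd_add g g' : pbnd g -> pbnd g' -> pbnd (fun x => g x + g' x).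
Proof.
move=> [c [d H]] [c' [d' H']]; exists (c + c'), (d + d') => x.
rewrite mulnDl leq_add //.
  by apply: leq_trans (H x) _; rewrite leq_mul2l leq_pexp2l ?leq_addr ?orbT.
by apply: leq_trans (H' x) _; rewrite leq_mul2l leq_pexp2l ?leq_addl ?orbT.
Qed.

Lemma pbnd_mul g g' : pbnd g -> pbnd g' -> pbnd (fun x => g x * g' x).
Proof.
move=> [c [d H]] [c' [d' H']]; exists (c * c'), (d + d') => x.
by rewrite expnD mulnACA leq_mul.
Qed.

Lemma pbnd_exp g d : pbnd g -> pbnd (fun x => g x ^ d).
Proof.
move=> Hg; elim: d => [|d IH]; first exact: pbnd_const.
by apply: pbnd_le (pbnd_mul Hg IH) => x; rewrite expnS.
Qed.

Lemma pbnd_poly g c d : pbnd g -> pbnd (fun x => c * (g x).+1 ^ d).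
Proof.
move=> Hg; apply: pbnd_mul; first exact: pbnd_const.
apply: pbnd_exp; apply: pbnd_le (pbnd_add Hg (pbnd_const 1)) => x.
by rewrite addn1.
Qed.

End PolyBound.

(** * Polynomial-time functions and their closure properties *)

Section Poly.
Context {X Y : Type} {EX : Enc X} {EY : Enc Y}.

Definition pt (f : X -> Y) : Prop :=
  exists p c d, forall x,
    exists2 t, runs p (enc x) (enc (f x)) t & t <= c * (sz x).+1 ^ d.

Lemma pt_intro p (g : X -> nat) f :
  pbnd g -> (forall x, exists2 t, runs p (enc x) (enc (f x)) t & t <= g x) -> pt f.
Proof.
move=> [c [d Hg]] H; exists p, c, d => x; have [t Ht le] := H x.
by exists t => //; apply: leq_trans le (Hg x).
Qed.

Lemma pt_bound f : pt f ->
  exists p, exists2 g : X -> nat, pbnd g &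
    forall x, exists2 t, runs p (enc x) (enc (f x)) t & t <= g x.
Proof. by move=> [p [c [d H]]]; exists p, (fun x => c * (sz x).+1 ^ d) => //; exists c, d. Qed.

(** The cost of a run dominates the size of its output ([runs_size]). This is what keeps
    compositions polynomial. *)
Lemma pt_sz f : pt f -> pbnd (fun x => sz (f x)).
Proof.
move=> [p [c [d H]]]; exists c, d => x; have [t Ht le] := H x.
by apply: leq_trans le; apply: leq_trans (runs_size Ht); rewrite leq_addl.
Qed.

Lemma pt_ext f g : f =1 g -> pt g -> pt f.
Proof. by move=> fg [p [c [d H]]]; exists p, c, d => x; rewrite fg; exact: H. Qed.

Lemma pt_prim q f :
  (forall x, prim_eval q (enc x) = Some (enc (f x))) ->
  pbnd (fun x => sz (f x)) -> pt f.
Proof.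
move=> H Hb; apply: (@pt_intro (Prim q) (fun x => sz x + sz (f x))).
  exact: pbnd_add pbnd_sz Hb.
by move=> x; exists (sz x + sz (f x)) => //; constructor.
Qed.

Lemma pt_const (y : Y) : pt (fun _ : X => y).
Proof. by apply: (@pt_prim (Const (enc y))) => //; exact: pbnd_const. Qed.

End Poly.

Lemma pt_id {X} {EX : Enc X} : pt (fun x : X => x).
Proof. by apply: (@pt_prim _ _ _ _ Id) => //; exact: pbnd_sz. Qed.

Lemma pbnd_comp X Y (EX : Enc X) (EY : Enc Y) (f : X -> Y) (g : Y -> nat) :
  pt f -> pbnd g -> pbnd (fun x => g (f x)).
Proof.
by move=> /pt_sz Hf [c [d H]]; apply: pbnd_le (pbnd_poly c d Hf) => x; exact: H.
Qed.

Lemma pt_comp X Y Z (EX : Enc X) (EY : Enc Y) (EZ : Enc Z) (g : Y -> Z) (f : X -> Y) :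
  pt g -> pt f -> pt (fun x => g (f x)).
Proof.
move=> ptg ptf.
have [q [b Hb Hq]] := pt_bound ptg; have [p [a Ha Hp]] := pt_bound ptf.
apply: (@pt_intro _ _ _ _ (Seq p q) (fun x => a x + b (f x))).
  exact: pbnd_add Ha (pbnd_comp ptf Hb).
move=> x; have [s Hs les] := Hp x; have [t Ht let_] := Hq (f x).
by exists (s + t); [apply: RunSeq Hs Ht | exact: leq_add].
Qed.

Section Combinators.
Context {E X Y Z : Type} {EE : Enc E} {EX : Enc X} {EY : Enc Y} {EZ : Enc Z}.

Lemma pt_pair (f : E -> X) (g : E -> Y) : pt f -> pt g -> pt (fun e => (f e, g e)).
Proof.
move=> ptf ptg; have [p [a Ha Hp]] := pt_bound ptf; have [q [b Hb Hq]] := pt_bound ptg.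
apply: (@pt_intro _ _ _ _ (Fork p q) (fun x => a x + b x + 1)).
  exact: pbnd_add (pbnd_add Ha Hb) (pbnd_const _).
move=> x; have [s Hs les] := Hp x; have [t Ht let_] := Hq x.
by exists (s + t).+1; [exact: RunFork | rewrite addn1 ltnS leq_add].
Qed.

Lemma pt_fst (f : E -> X * Y) : pt f -> pt (fun e => (f e).1).
Proof.
move=> Hf; apply: (pt_comp (g := fst)) Hf.
apply: (@pt_prim _ _ _ _ Fst) => //; apply: pbnd_le pbnd_sz => -[x y] /=.
by rewrite /sz /enc /= leqW ?leq_addr.
Qed.

Lemma pt_snd (f : E -> X * Y) : pt f -> pt (fun e => (f e).2).
Proof.
move=> Hf; apply: (pt_comp (g := snd)) Hf.
apply: (@pt_prim _ _ _ _ Snd) => //; apply: pbnd_le pbnd_sz => -[x y] /=.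
by rewrite /sz /enc /= leqW ?leq_addl.
Qed.

(** The test may have any encoded type: [Num 0] encodes [false], [0], [None] and the empty list
    alike. *)
Lemma pt_if_truthy (b : E -> Z) (f g : E -> X) :
  pt b -> pt f -> pt g -> pt (fun e => if truthy (enc (b e)) then f e else g e).
Proof.
move=> ptb ptf ptg; have [r [c Hc Hr]] := pt_bound ptb.
have [p [a Ha Hp]] := pt_bound ptf; have [q [d Hd Hq]] := pt_bound ptg.
apply: (@pt_intro _ _ _ _ (If r p q) (fun x => c x + (a x + d x))).
  exact: pbnd_add Hc (pbnd_add Ha Hd).
move=> x; have [s Hs les] := Hr x; have [t Ht let_] := Hp x; have [u Hu leu] := Hq x.
case E1: (truthy _).
- exists (s + t); last by rewrite leq_add // (leq_trans let_) // leq_addr.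
  by apply: RunIf Hs _; rewrite E1.
exists (s + u); last by rewrite leq_add // (leq_trans leu) // leq_addl.
by apply: RunIf Hs _; rewrite E1.
Qed.

End Combinators.

Lemma pt_if E X (EE : Enc E) (EX : Enc X) (b : E -> bool) (f g : E -> X) :
  pt b -> pt f -> pt g -> pt (fun e => if b e then f e else g e).
Proof.
by move=> ptb ptf ptg; apply: pt_ext (pt_if_truthy ptb ptf ptg) => e; case: (b e).
Qed.

Lemma pt_isSome E X (EE : Enc E) (EX : Enc X) (f : E -> option X) :
  pt f -> pt (fun e => isSome (f e)).
Proof.
move=> ptf; apply: pt_ext (pt_if_truthy ptf (pt_const true) (pt_const false)).
by move=> e; case: (f e).
Qed.

(** [Some x] and [(1, x)] have the same encoding, so the program for the pair serves unchanged; so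
    do [x :: s] and [(x, s)] in [pt_cons]. *)
Lemma pt_some E X (EE : Enc E) (EX : Enc X) (f : E -> X) :
  pt f -> pt (fun e => Some (f e)).
Proof. by move=> ptf; have [p [c [d H]]] := pt_pair (pt_const 1) ptf; exists p, c, d. Qed.

Lemma pt_cons E X (EE : Enc E) (EX : Enc X) (f : E -> X) (g : E -> seq X) :
  pt f -> pt g -> pt (fun e => f e :: g e).
Proof. by move=> ptf ptg; have [p [c [d H]]] := pt_pair ptf ptg; exists p, c, d. Qed.

(** The program is written by hand because the projection [Snd] is defined only in the branch of
    [Some], where no total function on options expresses it. *)
Lemma pt_odflt E X (EE : Enc E) (EX : Enc X) (x : X) (f : E -> option X) :
  pt f -> pt (fun e => odflt x (f e)).
Proof.
move=> ptf; apply: (pt_comp (g := odflt x)) ptf.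
apply: (@pt_intro _ _ _ _ (If (Prim Id) (Prim Snd) (Prim (Const (enc x))))
   (fun o => (sz o + sz o) + (sz o + (sz o + sz x)))).
  by do ?apply: pbnd_add; try exact: pbnd_sz; exact: pbnd_const.
move=> [y|]; last first.
  exists ((sz (@None X) + sz (@None X)) + (sz (@None X) + sz x)).
    by apply: RunIf; [apply: RunPrim | apply: RunPrim].
  by rewrite leq_add2l leq_add2l leq_addl.
exists ((sz (Some y) + sz (Some y)) + (sz (Some y) + sz y)).
  by apply: RunIf; [apply: RunPrim | apply: RunPrim].
rewrite !leq_add2l; apply: leq_trans (leq_addr _ _).
by rewrite /sz /enc /= leqW ?leq_addl.
Qed.

(** * Bit lengths and arithmetic *)

Lemma bit_length_leq m n : m <= n -> bit_length m <= bit_length n.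
Proof. by move=> H; rewrite /bit_length ltnS leq_trunc_log. Qed.

Lemma bit_length_bound n k : n < 2 ^ k -> 0 < k -> bit_length n <= k.
Proof.
move=> H k0; rewrite /bit_length.
case: (posnP n) => [->|n0]; first by rewrite trunc_log0.
by rewrite -(@ltn_exp2l 2) //; apply: leq_ltn_trans (trunc_logP _ _) H.
Qed.

Lemma bit_length_ltn n : n < 2 ^ bit_length n.
Proof. exact: trunc_log_ltn. Qed.

Lemma bit_length_add m n : bit_length (m + n) <= bit_length m + bit_length n.
Proof.
apply: bit_length_bound; last by rewrite addSn.
have hm := bit_length_ltn m; have hn := bit_length_ltn n.
(* Both powers are at least 2, so their sum is at most their product. *)
have pm : 1 < 2 ^ bit_length m by rewrite -{1}(expn0 2) ltn_exp2l.
have pn : 1 < 2 ^ bit_length n by rewrite -{1}(expn0 2) ltn_exp2l.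
rewrite expnD; nia.
Qed.

Lemma bit_length_mul m n : bit_length (m * n) <= bit_length m + bit_length n.
Proof.
apply: bit_length_bound; last by rewrite addSn.
by rewrite expnD ltn_mul // bit_length_ltn.
Qed.

Section Arithmetic.
Variables (E : Type) (EE : Enc E) (f g : E -> nat) (ptf : pt f) (ptg : pt g).

Lemma pt_arith o : pt (fun e => arith_eval o (f e) (g e)).
Proof.
apply: (pt_comp (g := fun p : nat * nat => arith_eval o p.1 p.2)) (pt_pair ptf ptg).
apply: (@pt_prim _ _ _ _ (Arith o)) => //.
apply: pbnd_le pbnd_sz => -[m n]; rewrite /sz /= /enc /=.
apply: leqW; case: o => /=.
- exact: bit_length_add.
- by apply: leq_trans (leq_addr _ _); rewrite bit_length_leq ?leq_subr.
- exact: bit_length_mul.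
by apply: leq_trans (leq_addr _ _); rewrite bit_length_leq ?leq_div.
Qed.

Lemma pt_add : pt (fun e => f e + g e). Proof. exact: (pt_arith Add). Qed.
Lemma pt_sub : pt (fun e => f e - g e). Proof. exact: (pt_arith Defs.Sub). Qed.
Lemma pt_mul : pt (fun e => f e * g e). Proof. exact: (pt_arith Mul). Qed.
Lemma pt_div : pt (fun e => f e %/ g e). Proof. exact: (pt_arith Div). Qed.

End Arithmetic.

Lemma pt_succ E (EE : Enc E) (f : E -> nat) : pt f -> pt (fun e => (f e).+1).
Proof.
by move=> ptf; apply: pt_ext (pt_add ptf (pt_const 1)) => e; rewrite addn1.
Qed.

(* The loop state is the triple (environment, unread part of the list,
   accumulator).  The accumulator must grow additively: with a step such as
   squaring, its size would be exponential in the length of the list. *)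
Section Fold.
Context {E X Y A : Type} {EE : Enc E} {EX : Enc X} {EY : Enc Y} {EA : Enc A}.

Let state (e : E) (s : seq X) (a : A) : value := enc (e, (s, a)).

Let test : prog := Defs.Seq (Prim Snd) (Prim Fst).

Let body (step : prog) : prog :=
  Fork (Prim Fst)
    (Fork (Defs.Seq test (Prim Snd))
          (Defs.Seq (Fork (Fork (Prim Fst) (Defs.Seq test (Prim Fst)))
                          (Defs.Seq (Prim Snd) (Prim Snd))) step)).

Let loop (step : prog) : prog := While test (body step).

(** [M] bounds every state that the loop reaches. One round costs at most [50 * M.+1] for
    projections and pairings, plus the cost of [step] on an argument no larger than [M]. *)
Lemma fold_loop (F : E * X * A -> A) step c d (e : E) :
  (forall u, exists2 t, runs step (enc u) (enc (F u)) t & t <= c * (sz u).+1 ^ d) ->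
  forall (s : seq X) (a : A) M,
  (forall s1 s2, s = s1 ++ s2 ->
     vsize (state e s2 (foldl (fun a x => F (e, x, a)) a s1)) <= M) ->
  exists2 t, runs (loop step) (state e s a)
                  (state e [::] (foldl (fun a x => F (e, x, a)) a s)) t &
    t <= (size s).+1 * (50 * M.+1 + c * M.+1 ^ d).
Proof.
move=> Hstep; elim=> [|x s IH] a M HM.
  have := HM [::] [::] erefl; rewrite /= => h0.
  eexists.
    apply: RunWhileStop; first by apply: RunSeq; apply: RunPrim; reflexivity.
    by [].
  move: h0; rewrite /state /enc /= /enc /=; lia.
have h0 := HM [::] (x :: s) erefl; rewrite /= in h0.
have [t Ht let_] := Hstep (e, x, a).
have [u Hu leu] := IH (F (e, x, a)) M (fun s1 s2 eq => HM (x :: s1) s2 (congr1 (cons x) eq)).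
have h1 := HM [:: x] s erefl; rewrite /= in h1.
have le_sz : (sz (e, x, a)).+1 <= M.+1.
  by move: h0; rewrite /state /sz /enc /= /enc /=; lia.
have let2 : t <= c * M.+1 ^ d.
  apply: leq_trans let_ _; rewrite leq_mul2l; apply/orP; right.
  by case: d {Hstep IH leu} => // d; rewrite leq_exp2r.
eexists.
  apply: RunWhileStep; first by apply: RunSeq; apply: RunPrim; reflexivity.
  - by [].
  - apply: RunFork; first by apply: RunPrim; reflexivity.
    apply: RunFork.
      apply: RunSeq; first by apply: RunSeq; apply: RunPrim; reflexivity.
      exact: (@RunPrim Snd _ (enc s)).
    apply: RunSeq Ht; apply: RunFork.
      apply: RunFork; first by apply: RunPrim; reflexivity.
      apply: RunSeq; first by apply: RunSeq; apply: RunPrim; reflexivity.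
      by apply: RunPrim; reflexivity.
    by apply: RunSeq; apply: RunPrim; reflexivity.
  - exact: Hu.
rewrite mulSn [size (x :: s)]/=.
set W := 50 * M.+1 + c * M.+1 ^ d in leu *.
apply: (@leq_trans (W + u)); last by rewrite leq_add2l.
rewrite leq_add2r /W; move: h0 h1; rewrite /state /enc /= /enc /=. lia.
Qed.

(** The step is split into [g], which may be any polynomial-time function of the environment and the
    element, and [h], which alone touches the accumulator and must grow additively. The increments
    are then uniformly polynomial, hence so is every intermediate state. *)
Lemma pt_foldl (i : E -> A) (l : E -> seq X) (g : E -> X -> Y) (h : A -> Y -> A) :
  pt i -> pt l -> pt (fun p : E * X => g p.1 p.2) ->
  pt (fun p : A * Y => h p.1 p.2) ->
  (exists k, forall a y, sz (h a y) <= sz a + sz y + k) ->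
  pt (fun e => foldl (fun a x => h a (g e x)) (i e) (l e)).
Proof.
move=> pti ptl ptg pth [k Hk].
have ptF : pt (fun u : E * X * A => h u.2 (g u.1.1 u.1.2)).
  refine (pt_comp (f := fun u : E * X * A => (u.2, g u.1.1 u.1.2)) pth _).
  by refine (pt_pair (pt_snd pt_id) (pt_comp ptg (pt_fst pt_id))).
have [step [c [d Hstep]]] := ptF.
have [c' [d' Hg]] := pt_sz ptg.
have [pinit [ci [di Hi]]] := pt_pair pt_id (pt_pair ptl pti).
(* [S e] bounds the argument of [g] for every element of the list. [M e] allows one increment per
   element, with [sz (l e)] as a bound on their number. *)
pose (S := fun e : E => (sz e + sz (l e)).+2).
pose (M := fun e : E => sz e + (sz (l e) + (sz (i e) + sz (l e) * (c' * (S e) ^ d' + k))).+2).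
apply: (@pt_intro _ _ _ _ (Defs.Seq pinit (Defs.Seq (loop step) (Defs.Seq (Prim Snd) (Prim Snd))))
  (fun e => ci * (sz e).+1 ^ di + ((sz (l e)).+1 * (50 * (M e).+1 + c * (M e).+1 ^ d) + 10 * M e))).
  have Hl := pt_sz ptl; have Hii := pt_sz pti.
  have HS : pbnd S.
    by apply: pbnd_le (pbnd_add (pbnd_add pbnd_sz Hl) (pbnd_const 2)) => e; rewrite addn2.
  have HM : pbnd M.
    apply: pbnd_le (pbnd_add pbnd_sz (pbnd_add (pbnd_add Hl (pbnd_add Hii (pbnd_mul Hl
      (pbnd_add (pbnd_mul (pbnd_const c') (pbnd_exp d' HS)) (pbnd_const k))))) (pbnd_const 2))) => e.
    by rewrite addn2.
  apply: pbnd_add; first exact: pbnd_poly pbnd_sz.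
  apply: pbnd_add; last exact: pbnd_mul (pbnd_const _) HM.
  apply: pbnd_mul.
    by apply: pbnd_le (pbnd_add Hl (pbnd_const 1)) => e; rewrite addn1.
  apply: pbnd_add; last exact: pbnd_poly HM.
  by apply: pbnd_mul (pbnd_const _) _; apply: pbnd_le (pbnd_add HM (pbnd_const 1)) => e; rewrite addn1.
move=> e; have [t1 H1 le1] := Hi e.
pose G := c' * (S e) ^ d' + k.
have sz_cat (s1 s2 : seq X) : size s1 + sz s2 <= sz (s1 ++ s2).
  by elim: s1 => //= x s1 IH; rewrite sz_cons; lia.
have sz_mem (s1 s2 : seq X) x : sz x <= sz (s1 ++ x :: s2).
  by elim: s1 => [|y s1 IH]; rewrite ?cat_cons sz_cons; lia.
have growth s1 s2 a0 : l e = s1 ++ s2 -> forall s3, (exists s4, s1 = s4 ++ s3) ->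
    sz (foldl (fun a x => h a (g e x)) a0 s3) <= sz a0 + size s3 * G.
  move=> le_ s3; elim: s3 a0 => [|x s3 IH] a0 [s4 E4] //=; first by rewrite addn0.
  have /IH IH' : exists s4, s1 = s4 ++ s3 by exists (rcons s4 x); rewrite cat_rcons.
  apply: leq_trans (IH' _) _; rewrite mulSn addnA leq_add2r.
  apply: leq_trans (Hk _ _) _; rewrite -addnA leq_add2l /G leq_add2r.
  apply: leq_trans (Hg (e, x)) _; rewrite leq_mul2l; apply/orP; right.
  have : (sz (e, x)).+1 <= S e.
    rewrite /S le_ E4 -catA cat_cons.
    have := sz_mem s4 (s3 ++ s2) x; rewrite sz_pair; lia.
  by case: (d') => // d0; rewrite leq_exp2r.
have Minv s1 s2 : l e = s1 ++ s2 ->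
    vsize (state e s2 (foldl (fun a x => h a (g e x)) (i e) s1)) <= M e.
  move=> le_; have gr := growth s1 s2 (i e) le_ s1 (ex_intro _ [::] erefl).
  have := sz_cat s1 s2; rewrite -le_ => leS.
  have : size s1 * G <= sz (l e) * G by rewrite leq_mul2r; apply/orP; right; lia.
  rewrite /M -/G /state /enc /= -/(sz e) -/(sz s2) -/(sz (foldl _ _ _)).
  by move: gr leS; lia.
have [t2 H2 le2] := @fold_loop _ step c d e Hstep (l e) (i e) (M e) Minv.
eexists.
  apply: RunSeq; first exact: H1.
  apply: RunSeq; first exact: H2.
  by apply: RunSeq; apply: RunPrim; reflexivity.
apply: leq_add => //; apply: leq_add.
  apply: leq_trans le2 _; rewrite leq_mul2r; apply/orP; right.
  by have := sz_cat (l e) [::]; rewrite cats0; lia.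
have := Minv (l e) [::]; rewrite cats0 => /(_ erefl).
rewrite /state /enc /= /enc /=; lia.
Qed.

End Fold.

(** * Tests, comparisons and list operations *)

Section Logic.
Context {E : Type} {EE : Enc E}.
Implicit Types (f g : E -> nat) (a b : E -> bool).

Lemma pt_and a b : pt a -> pt b -> pt (fun e => a e && b e).
Proof. by move=> pta ptb; apply: pt_ext (pt_if pta ptb (pt_const false)) => e; case: (a e). Qed.

Lemma pt_eq0 f : pt f -> pt (fun e => f e == 0).
Proof.
move=> ptf; apply: pt_ext (pt_if_truthy ptf (pt_const false) (pt_const true)) => e.
by case: (f e).
Qed.

(** By definition [m <= n] is [m - n == 0], so truncated subtraction decides the order. *)
Lemma pt_leq f g : pt f -> pt g -> pt (fun e => f e <= g e).
Proof. by move=> ptf ptg; apply: pt_eq0 (pt_sub ptf ptg). Qed.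

Lemma pt_eqn f g : pt f -> pt g -> pt (fun e => f e == g e).
Proof.
move=> ptf ptg; apply: pt_ext (pt_and (pt_leq ptf ptg) (pt_leq ptg ptf)) => e.
by rewrite eqn_leq.
Qed.

Lemma pt_minn f g : pt f -> pt g -> pt (fun e => minn (f e) (g e)).
Proof. by move=> ptf ptg; apply: pt_if (pt_leq (pt_succ ptf) ptg) ptf ptg. Qed.

End Logic.

Lemma pt_eq_pair E (X Y : eqType) (EE : Enc E) (EX : Enc X) (EY : Enc Y) (f g : E -> X * Y) :
  pt (fun e => (f e).1 == (g e).1) -> pt (fun e => (f e).2 == (g e).2) ->
  pt (fun e => f e == g e).
Proof. exact: pt_and. Qed.


Lemma foldl_consE X Y (g : X -> Y) a s :
  foldl (fun a x => g x :: a) a s = catrev (map g s) a.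
Proof. by elim: s a => //= x s IH a; rewrite IH. Qed.

Lemma sz_cat X (EX : Enc X) (s t : seq X) : sz (s ++ t) <= sz s + sz t.
Proof. by elim: s => [|x s IH] /=; rewrite ?cat_cons ?sz_cons; lia. Qed.

Section Lists.
Context {E X Y : Type} {EE : Enc E} {EX : Enc X} {EY : Enc Y}.

Lemma pt_catrev (l : E -> seq X) (a : E -> seq X) :
  pt l -> pt a -> pt (fun e => catrev (l e) (a e)).
Proof.
move=> ptl pta.
apply: pt_ext (pt_foldl (g := fun _ x => x) (h := fun a x => x :: a) pta ptl
  (pt_snd pt_id) (pt_cons (pt_snd pt_id) (pt_fst pt_id)) _).
  by move=> e; rewrite (foldl_consE id) map_id.
by exists 1 => s x; rewrite sz_cons; lia.
Qed.

(** A fold that accumulates by [cons] reverses its input, so the list is reversed first. *)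
Lemma pt_map (l : E -> seq X) (g : E -> X -> Y) :
  pt l -> pt (fun p : E * X => g p.1 p.2) -> pt (fun e => [seq g e x | x <- l e]).
Proof.
move=> ptl ptg.
apply: pt_ext (pt_foldl (h := fun a x => x :: a) (pt_const [::])
  (pt_catrev ptl (pt_const [::])) ptg (pt_cons (pt_snd pt_id) (pt_fst pt_id)) _).
  by move=> e; rewrite foldl_consE -[catrev (l e) _]/(rev _) map_rev -/(rev _) revK.
by exists 1 => s x; rewrite sz_cons; lia.
Qed.

End Lists.

Lemma pt_rev E X (EE : Enc E) (EX : Enc X) (l : E -> seq X) :
  pt l -> pt (fun e => rev (l e)).
Proof. by move=> ptl; apply: pt_catrev ptl (pt_const [::]). Qed.

Lemma pt_cat E X (EE : Enc E) (EX : Enc X) (l : E -> seq X) (a : E -> seq X) :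
  pt l -> pt a -> pt (fun e => l e ++ a e).
Proof.
move=> ptl pta; apply: pt_ext (pt_catrev (pt_rev ptl) pta) => e.
by rewrite catrevE revK.
Qed.

Lemma pt_flatten E X (EE : Enc E) (EX : Enc X) (l : E -> seq (seq X)) :
  pt l -> pt (fun e => flatten (l e)).
Proof.
move=> ptl.
apply: pt_ext (pt_foldl (g := fun _ x => x) (h := fun a x => a ++ x) (pt_const [::]) ptl
  (pt_snd pt_id) (pt_cat (pt_fst pt_id) (pt_snd pt_id)) _).
  move=> e; rewrite -[LHS]cat0s; elim: (l e) [::] => [|x s IH] a /=; first by rewrite cats0.
  by rewrite -IH catA.
by exists 0 => s t; rewrite addn0 sz_cat.
Qed.

Lemma pt_allpairs E X Y Z (EE : Enc E) (EX : Enc X) (EY : Enc Y) (EZ : Enc Z)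
    (g : E -> X -> Y -> Z) (l : E -> seq X) (m : E -> seq Y) :
  pt l -> pt m -> pt (fun p : E * X * Y => g p.1.1 p.1.2 p.2) ->
  pt (fun e => [seq g e x y | x <- l e, y <- m e]).
Proof.
move=> ptl ptm ptg; apply: pt_flatten; apply: (pt_map ptl).
apply: (pt_map (g := fun p : E * X => g p.1 p.2)) => //.
exact: pt_comp ptm (pt_fst pt_id).
Qed.

Lemma pt_sum E X (EE : Enc E) (EX : Enc X) (l : E -> seq X) (g : E -> X -> nat) :
  pt l -> pt (fun p : E * X => g p.1 p.2) -> pt (fun e => \sum_(x <- l e) g e x).
Proof.
move=> ptl ptg.
apply: pt_ext (pt_foldl (h := addn) (pt_const 0) ptl ptg
  (pt_add (pt_fst pt_id) (pt_snd pt_id)) _).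
  have H a s e : foldl (fun a x => a + g e x) a s = a + \sum_(x <- s) g e x.
    by elim: s a => [|x s IH] a /=; rewrite ?big_nil ?addn0 // big_cons IH addnA.
  by move=> e; rewrite H.
by exists 0 => a b; rewrite addn0; exact: bit_length_add.
Qed.

(** Multiplication is an additive step: the bit length of a product is at most the sum of the bit
    lengths. *)
Lemma pt_prod E X (EE : Enc E) (EX : Enc X) (l : E -> seq X) (g : E -> X -> nat) :
  pt l -> pt (fun p : E * X => g p.1 p.2) -> pt (fun e => \prod_(x <- l e) g e x).
Proof.
move=> ptl ptg.
apply: pt_ext (pt_foldl (h := muln) (pt_const 1) ptl ptg
  (pt_mul (pt_fst pt_id) (pt_snd pt_id)) _).
  have H a s e : foldl (fun a x => a * g e x) a s = a * \prod_(x <- s) g e x.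
    by elim: s a => [|x s IH] a /=; rewrite ?big_nil ?muln1 // big_cons IH mulnA.
  by move=> e; rewrite H mul1n.
by exists 0 => a b; rewrite addn0; exact: bit_length_mul.
Qed.

Lemma sz_bool (b : bool) : sz b = 1. Proof. by case: b. Qed.

Lemma pt_all E X (EE : Enc E) (EX : Enc X) (l : E -> seq X) (g : E -> X -> bool) :
  pt l -> pt (fun p : E * X => g p.1 p.2) -> pt (fun e => all (g e) (l e)).
Proof.
move=> ptl ptg.
apply: pt_ext (pt_foldl (h := andb) (pt_const true) ptl ptg
  (pt_and (pt_fst pt_id) (pt_snd pt_id)) _).
  have H a s e : foldl (fun a x => a && g e x) a s = a && all (g e) s.
    by elim: s a => [|x s IH] a /=; rewrite ?andbT // IH andbA.
  by move=> e; rewrite H.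
by exists 0 => a b; rewrite !sz_bool.
Qed.

Lemma pt_not E (EE : Enc E) (b : E -> bool) : pt b -> pt (fun e => ~~ b e).
Proof. by move=> ptb; apply: pt_ext (pt_if ptb (pt_const false) (pt_const true)). Qed.

Lemma pt_has E X (EE : Enc E) (EX : Enc X) (l : E -> seq X) (g : E -> X -> bool) :
  pt l -> pt (fun p : E * X => g p.1 p.2) -> pt (fun e => has (g e) (l e)).
Proof.
move=> ptl ptg; apply: pt_ext (pt_not (pt_all ptl (pt_not ptg))) => e.
by rewrite -[LHS]negbK -all_predC.
Qed.

Definition first_some X (s : seq (option X)) : option X :=
  foldl (fun a y => if isSome a then a else y) None s.

Lemma pt_first_some E X (EE : Enc E) (EX : Enc X) (l : E -> seq (option X)) :
  pt l -> pt (fun e => first_some (l e)).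
Proof.
move=> ptl; apply: (pt_foldl (g := fun _ y => y)
  (h := fun a y => if isSome a then a else y) (pt_const None) ptl (pt_snd pt_id)).
  by refine (pt_if (pt_isSome (pt_fst pt_id)) (pt_fst pt_id) (pt_snd pt_id)).
by exists 0 => -[a|] y /=; lia.
Qed.

Lemma sz_leq (m n : nat) : m <= n -> sz m <= sz n.
Proof. exact: bit_length_leq. Qed.

Definition indexed X (s : seq X) : seq (nat * X) := zip (iota 0 (size s)) s.

(* The counter is capped by the length of the list, which the step receives
   together with the next element: otherwise the step, which copies the
   counter, would not be additive. *)
Lemma pt_indexed E X (EE : Enc E) (EX : Enc X) (l : E -> seq X) :
  pt l -> pt (fun e => indexed (l e)).
Proof.
move=> ptl.
have ptN : pt (fun e => \sum_(x <- l e) 1) by apply: (pt_sum ptl); exact: pt_const.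
have ptN1 : pt (fun p : E * X => \sum_(x <- l p.1) 1).
  exact: (pt_comp (f := fun p : E * X => p.1)) ptN (pt_fst pt_id).
pose h (a : nat * seq (nat * X)) (y : nat * (nat * X)) :=
  (minn a.1.+1 y.1, (minn a.1 y.2.1, y.2.2) :: a.2).
have ptg : pt (fun p : E * X => (\sum_(x <- l p.1) 1, (\sum_(x <- l p.1) 1, p.2))).
  by refine (pt_pair ptN1 (pt_pair ptN1 (pt_snd pt_id))).
have pth : pt (fun p : nat * seq (nat * X) * (nat * (nat * X)) => h p.1 p.2).
  refine (pt_pair (pt_minn (pt_succ (pt_fst (pt_fst pt_id))) (pt_fst (pt_snd pt_id))) _).
  refine (pt_cons (pt_pair _ (pt_snd (pt_snd (pt_snd pt_id)))) (pt_snd (pt_fst pt_id))).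
  exact: (pt_minn (pt_fst (pt_fst pt_id)) (pt_fst (pt_snd (pt_snd pt_id)))).
have growth : exists k, forall a y, sz (h a y) <= sz a + sz y + k.
  exists 2 => -[c s] [N [N' x]]; rewrite /h /= !sz_pair sz_cons sz_pair.
  have := sz_leq (geq_minr c.+1 N); have := sz_leq (geq_minr c N'); lia.
have ptfold := pt_foldl (g := fun e x => (\sum_(x <- l e) 1, (\sum_(x <- l e) 1, x)))
  (pt_const (0, [::])) ptl ptg pth growth.
apply: pt_ext (pt_rev (pt_snd ptfold)) => e; rewrite sum1_size /indexed.
(* Along the list the counter never exceeds the length, so the caps do not change it. *)
have H n s a : n + size s <= size (l e) ->
    foldl (fun a x => h a (size (l e), (size (l e), x))) (n, a) s =
    (n + size s, catrev (zip (iota n (size s)) s) a).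
  elim: s n a => [|x s IH] n a /=; first by rewrite addn0.
  move=> le_n; rewrite /h /= (minn_idPl _); last lia.
  rewrite (minn_idPl _); last lia.
  by rewrite IH ?addSnnS //; lia.
by rewrite H //= -/(rev _) revK.
Qed.

(** Descends along the head symbol of the function body. Goals with another head, such as
    conditionals and equality tests, are left open. *)
Ltac pt_solve := cbv beta;
  lazymatch goal with
  | |- pt (fun e => e) => exact: pt_id
  | |- pt (fun _ => ?c) => exact: pt_const
  | H : pt ?f |- pt ?f => exact: H
  | |- pt (@fst _ _) => exact: (pt_fst pt_id)
  | |- pt (@snd _ _) => exact: (pt_snd pt_id)
  | |- pt (fun e => fst (@?f e)) => refine (pt_fst (f := f) _); pt_solve
  | |- pt (fun e => snd (@?f e)) => refine (pt_snd (f := f) _); pt_solve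
  | |- pt (fun e => (@?f e, @?g e)) =>
      refine (pt_pair (f := f) (g := g) _ _); pt_solve
  | |- pt (fun e => @?f e :: @?g e) =>
      refine (pt_cons (f := f) (g := g) _ _); pt_solve
  | |- pt (fun e => Some (@?f e)) => refine (pt_some (f := f) _); pt_solve
  | |- pt (fun e => isSome (@?f e)) => refine (pt_isSome (f := f) _); pt_solve
  | |- pt (fun e => odflt ?x (@?f e)) => refine (pt_odflt x (f := f) _); pt_solve
  | |- pt (fun e => (@?f e).+1) => refine (pt_succ (f := f) _); pt_solve
  | |- pt (fun e => @?f e * @?g e) => refine (pt_mul (f := f) (g := g) _ _); pt_solve
  | |- pt (fun e => @?f e %/ @?g e) => refine (pt_div (f := f) (g := g) _ _); pt_solve
  | |- pt (fun e => @?f e <= @?g e) => refine (pt_leq (f := f) (g := g) _ _); pt_solve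
  | |- pt (fun e => @?a e && @?b e) => refine (pt_and (a := a) (b := b) _ _); pt_solve
  | |- pt (fun e => [seq @?g e x | x <- @?l e]) =>
      refine (pt_map (g := g) (l := l) _ _); pt_solve
  | |- pt (fun e => \sum_(x <- @?l e) @?g e x) =>
      refine (pt_sum (g := g) (l := l) _ _); pt_solve
  | |- pt (fun e => \prod_(x <- @?l e) @?g e x) =>
      refine (pt_prod (g := g) (l := l) _ _); pt_solve
  | |- pt (fun e => all (@?g e) (@?l e)) =>
      refine (pt_all (g := g) (l := l) _ _); pt_solve
  | |- pt (fun e => has (@?g e) (@?l e)) =>
      refine (pt_has (g := g) (l := l) _ _); pt_solve
  | |- pt (fun e => first_some (@?f e)) => refine (pt_first_some (l := f) _); pt_solve
  | |- pt (fun e => indexed (@?f e)) => refine (pt_indexed (l := f) _); pt_solve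
  | |- _ => idtac
  end.

(** * The algorithm *)

(* The same encoding as in [encode_schedule]: a list of decisions is already
   the required output. *)
Instance enc_set K : Enc {set 'I_K} :=
  fun B => encode_list [seq Defs.Num j.+1 | j : 'I_K <- enum B].

Instance enc_ad : Enc ad := encode_ad.

Definition numbers K (B : {set 'I_K}) : seq nat := [seq (j : nat).+1 | j : 'I_K <- enum B].

Lemma mem_numbers K (B : {set 'I_K}) (j : 'I_K) : (j.+1 \in numbers B) = (j \in B).
Proof.
apply/mapP/idP => [[i]|jB]; last by exists j; rewrite ?mem_enum.
by rewrite mem_enum => iB [] /val_inj ->.
Qed.

(** A set of slots and the list of its numbers have the same encoding, so the program for [f] is
    reused. *)
Lemma pt_numbers E (EE : Enc E) K (f : E -> {set 'I_K}) :
  pt f -> pt (fun e => numbers (f e)).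
Proof.
move=> [p [c [d H]]]; exists p, c, d => e; have [t Ht le] := H e; exists t => //.
by rewrite /numbers /enc /= /enc_seq -map_comp.
Qed.

Definition size_num (a : ad) : nat := `|numq (ad_size a)|.
Definition size_den (a : ad) : nat := `|denq (ad_size a)|.

Definition key : Type := nat * (nat * nat).
Lemma pt_eq_key E (EE : Enc E) (s t : E -> key) :
  pt s -> pt t -> pt (fun e => s e == t e).
Proof.
move=> pts ptt; apply: pt_eq_pair; first by apply: pt_eqn; pt_solve.
by apply: pt_eq_pair; apply: pt_eqn; pt_solve.
Qed.

Definition key_of (a : ad) : key := (ad_freq a, (ad_release a, ad_deadline a)).

Section AdPrograms.
Variables (E : Type) (EE : Enc E) (f : E -> ad) (ptf : pt f).

(** Reaching the fifth field takes five projections, each of cost at most twice the size of the ad;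
    20 leaves ample room. *)
Lemma pt_ad_component (g : ad -> nat) p :
  (forall a, exists2 t, runs p (enc a) (Defs.Num (g a)) t & t <= 20 * sz a) ->
  pt (fun e => g (f e)).
Proof.
move=> H; refine (pt_comp (g := g) (f := f) _ ptf).
apply: (@pt_intro _ _ _ _ p (fun a => 20 * sz a)); last exact: H.
exact: pbnd_mul (pbnd_const _) pbnd_sz.
Qed.

Lemma pt_size_num : pt (fun e => size_num (f e)).
Proof.
apply: (@pt_ad_component _ (Prim Fst)) => a; eexists; first by apply: RunPrim.
by rewrite /sz /enc /= /size_num; lia.
Qed.

Lemma pt_size_den : pt (fun e => size_den (f e)).
Proof.
apply: (@pt_ad_component _ (Defs.Seq (Prim Snd) (Prim Fst))) => a; eexists.
  by apply: RunSeq; apply: RunPrim; reflexivity.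
by rewrite /sz /enc /= /size_den; lia.
Qed.

Lemma pt_ad_freq : pt (fun e => ad_freq (f e)).
Proof.
apply: (@pt_ad_component _ (Defs.Seq (Prim Snd) (Defs.Seq (Prim Snd) (Prim Fst)))) => a.
eexists.
  by apply: RunSeq; last apply: RunSeq; apply: RunPrim; reflexivity.
by rewrite /sz /enc /=; lia.
Qed.

Lemma pt_ad_release : pt (fun e => ad_release (f e)).
Proof.
apply: (@pt_ad_component _ (Defs.Seq (Prim Snd) (Defs.Seq (Prim Snd)
  (Defs.Seq (Prim Snd) (Prim Fst))))) => a.
eexists.
  by apply: RunSeq; last apply: RunSeq; last apply: RunSeq; apply: RunPrim; reflexivity.
by rewrite /sz /enc /=; lia.
Qed.

Lemma pt_ad_deadline : pt (fun e => ad_deadline (f e)).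
Proof.
apply: (@pt_ad_component _ (Defs.Seq (Prim Snd) (Defs.Seq (Prim Snd)
  (Defs.Seq (Prim Snd) (Defs.Seq (Prim Snd) (Prim Fst)))))) => a.
eexists.
  by apply: RunSeq; last apply: RunSeq; last apply: RunSeq; last apply: RunSeq;
    apply: RunPrim; reflexivity.
by rewrite /sz /enc /=; lia.
Qed.

Lemma pt_key_of : pt (fun e => key_of (f e)).
Proof. exact: pt_pair pt_ad_freq (pt_pair pt_ad_release pt_ad_deadline). Qed.

End AdPrograms.

Section Algorithm.
Variable K : nat.

(* Index, scaled size and key of an ad. *)
Definition item : Type := nat * (nat * key).

(* The rule [((a, b), ((t, B), thr))] proposes the set of slots [B] for every
   ad with key [t], index in [a, b) and scaled size at most [thr]. *)
Definition rule : Type := (nat * nat) * ((key * {set 'I_K}) * nat).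

Definition decision : Type := option {set 'I_K}.

Definition common_den (s : seq ad) : nat := \prod_(a <- s) size_den a.

Definition scaled_size (D : nat) (a : ad) : nat := size_num a * (D %/ size_den a).

Definition items (s : seq ad) : seq item :=
  indexed [seq (scaled_size (common_den s) a, key_of a) | a <- s].

Definition matches (r : rule) (x : item) : bool :=
  [&& r.1.1 <= x.1, x.1.+1 <= r.1.2, x.2.1 <= r.2.2 & r.2.1.1 == x.2.2].

(** Rules may overlap; giving priority to the first match makes every list of rules describe a
    schedule. *)
Definition decide (g : seq rule) (x : item) : decision :=
  first_some [seq if matches r x then Some r.2.1.2 else None | r <- g].

Definition load (c : seq (item * decision)) (j : nat) : nat :=
  \sum_(y <- c) if has (fun i => i == j) (numbers (odflt set0 y.2)) then y.1.2.1 else 0.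

Definition profit (c : seq (item * decision)) : nat :=
  \sum_(y <- c) if isSome y.2 then y.1.2.1 * y.1.2.2.1 else 0.

(** Only the capacities need a test at run time: the rules are drawn from [assignments], whose sets
    respect frequency, release date and deadline. *)
Definition fits (D : nat) (c : seq (item * decision)) : bool :=
  all (fun j => load c j <= D) (numbers [set: 'I_K]).

Definition candidate (s : seq item) (g : seq rule) : seq (item * decision) :=
  [seq (x, decide g x) | x <- s].

Fixpoint guesses (H : nat) (U : seq rule) : seq (seq rule) :=
  if H is H'.+1 then [seq r :: g | r <- U, g <- guesses H' U] else [:: [::]].

Definition key_admits (t : key) (B : {set 'I_K}) : bool :=
  (#|B| == t.1) && [forall j in B, t.2.1 <= j.+1 <= t.2.2].

(** Release dates go up to [K + 1]: a valid ad of frequency 0 may have its release date just after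
    its deadline. *)
Definition keys : seq key :=
  [seq (w, rd) | w <- iota 0 K.+1, rd <- [seq (r, d) | r <- iota 0 K.+2, d <- iota 0 K.+1]].

Definition key_slots (t : key) : seq {set 'I_K} := [seq B <- enum {set 'I_K} | key_admits t B].

Definition assignments : seq (key * {set 'I_K}) :=
  [seq (t, B) | t <- keys, B <- key_slots t].

(** For [n] items the end points range over [0, ..., n]. Restricting the thresholds to 0 and the
    sizes present keeps the number of rules polynomial. *)
Definition rules (s : seq item) : seq rule :=
  let idx := 0 :: [seq x.1.+1 | x <- s] in
  [seq (ab, q) | ab <- [seq (a, b) | a <- idx, b <- idx],
                 q <- [seq (tB, z) | tB <- assignments, z <- 0 :: [seq x.2.1 | x <- s]]].

Definition best (y0 : nat * seq decision) (s : seq (bool * (nat * seq decision))) :=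
  foldl (fun a y => if y.1 && (a.1 <= y.2.1) then y.2 else a) y0 s.

(** The search starts from the empty schedule, so the output is feasible even if no guess fits. *)
Definition solve (H : nat) (ads : seq ad) : seq decision :=
  let s := items ads in
  (best (0, [seq None | x <- s])
    [seq (fits (common_den ads) (candidate s g),
           (profit (candidate s g), [seq y.2 | y <- candidate s g]))
    | g <- guesses H (rules s)]).2.

(** * Running time of the algorithm *)

Lemma pt_items E (EE : Enc E) (f : E -> seq ad) : pt f -> pt (fun e => items (f e)).
Proof.
move=> ptf; refine (pt_comp (g := items) (f := f) _ ptf).
have ptD : pt common_den.
  by rewrite /common_den; pt_solve; apply: pt_size_den; pt_solve.
rewrite /items; pt_solve.
  rewrite /scaled_size. apply: pt_mul; first by apply: pt_size_num; pt_solve.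
  apply: pt_div; last by apply: pt_size_den; pt_solve.
  by refine (pt_comp (f := fun e => e.1) ptD _); pt_solve.
by apply: pt_key_of; pt_solve.
Qed.

Lemma pt_matches E (EE : Enc E) (r : E -> rule) (x : E -> item) :
  pt r -> pt x -> pt (fun e => matches (r e) (x e)).
Proof. by move=> ptr ptx; rewrite /matches; pt_solve; apply: pt_eq_key; pt_solve. Qed.

Lemma pt_decide E (EE : Enc E) (g : E -> seq rule) (x : E -> item) :
  pt g -> pt x -> pt (fun e => decide (g e) (x e)).
Proof.
move=> ptg ptx; rewrite /decide; pt_solve; refine (pt_if _ _ _); pt_solve.
apply: pt_matches; first by pt_solve.
by refine (pt_comp (f := fun e => e.1) ptx _); pt_solve.
Qed.

Lemma pt_candidate E (EE : Enc E) (s : E -> seq item) (g : E -> seq rule) :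
  pt s -> pt g -> pt (fun e => candidate (s e) (g e)).
Proof.
move=> pts ptg; rewrite /candidate; pt_solve.
apply: pt_decide; last by pt_solve.
by refine (pt_comp (f := fun e => e.1) ptg _); pt_solve.
Qed.

Lemma pt_load E (EE : Enc E) (c : E -> seq (item * decision)) (j : E -> nat) :
  pt c -> pt j -> pt (fun e => load (c e) (j e)).
Proof.
move=> ptc ptj; rewrite /load; pt_solve; refine (pt_if _ _ _); pt_solve.
- by apply: pt_numbers; pt_solve.
- apply: pt_eqn; first by pt_solve.
  by refine (pt_comp (f := fun e => e.1.1) ptj _); pt_solve.
Qed.

Lemma pt_fits E (EE : Enc E) (D : E -> nat) (c : E -> seq (item * decision)) :
  pt D -> pt c -> pt (fun e => fits (D e) (c e)).
Proof.
move=> ptD ptc; rewrite /fits; pt_solve; last first.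
  by refine (pt_comp (f := fun e => e.1) ptD _); pt_solve.
apply: pt_load; last by pt_solve.
by refine (pt_comp (f := fun e => e.1) ptc _); pt_solve.
Qed.

Lemma pt_profit E (EE : Enc E) (c : E -> seq (item * decision)) :
  pt c -> pt (fun e => profit (c e)).
Proof. by move=> ptc; rewrite /profit; pt_solve; refine (pt_if _ _ _); pt_solve. Qed.

(** [H] is a constant of the program: the induction nests [H] loops over [U], which gives
    polynomially many guesses. *)
Lemma pt_guesses E (EE : Enc E) H (U : E -> seq rule) :
  pt U -> pt (fun e => guesses H (U e)).
Proof.
move=> ptU; elim: H => [|H IH] /=; first by pt_solve.
by refine (pt_allpairs (g := fun _ r g => r :: g) ptU IH _); pt_solve.
Qed.

Lemma pt_rules E (EE : Enc E) (s : E -> seq item) :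
  pt s -> pt (fun e => rules (s e)).
Proof.
move=> pts; rewrite /rules.
by refine (pt_allpairs (g := fun _ p q => (p, q))
  (pt_allpairs (g := fun _ p q => (p, q)) _ _ _)
  (pt_allpairs (g := fun _ p q => (p, q)) _ _ _) _); pt_solve.
Qed.

Lemma pt_best E (EE : Enc E) y0 (s : E -> seq (bool * (nat * seq decision))) :
  pt y0 -> pt s -> pt (fun e => best (y0 e) (s e)).
Proof.
move=> pty pts.
refine (pt_foldl (i := y0) (l := s) (g := fun _ y => y)
  (h := fun a y => if y.1 && (a.1 <= y.2.1) then y.2 else a) pty pts _ _ _).
- by pt_solve.
- by refine (pt_if _ _ _); pt_solve.
by exists 0 => a [b y] /=; rewrite sz_pair; case: ifP => _; lia.
Qed.

Lemma pt_solve_ads H : pt (solve H).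
Proof.
have pts : pt items by apply: pt_items; exact: pt_id.
have ptD : pt common_den.
  by rewrite /common_den; pt_solve; apply: pt_size_den; pt_solve.
rewrite /solve; pt_solve; apply: pt_best; first by pt_solve.
have ptc : pt (fun p : seq ad * seq rule => candidate (items p.1) p.2).
  apply: pt_candidate; last by pt_solve.
  by apply: pt_items; pt_solve.
pt_solve.
- by apply: pt_guesses; apply: pt_rules.
- apply: pt_fits => //; by refine (pt_comp (f := fun e => e.1) ptD _); pt_solve.
- exact: pt_profit.
Qed.

End Algorithm.

(** * Rounding a schedule to a short list of rules *)

Lemma leq_sum_mem (T : eqType) (s : seq T) (F : T -> nat) x :
  x \in s -> F x <= \sum_(y <- s) F y.
Proof. by move=> xs; rewrite (big_rem x) //= leq_addr. Qed.

Lemma sum_uniq_pred1 (T : eqType) (s : seq T) (F : T -> nat) x :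
  uniq s -> \sum_(y <- s) (if y == x then F y else 0) = if x \in s then F x else 0.
Proof.
elim: s => [|y s IH]; first by rewrite big_nil.
move=> /= /andP[ys us]; rewrite big_cons IH // in_cons.
case: (eqVneq y x) => [<-|yx]; first by rewrite (negPf ys) ?eqxx addn0.
by rewrite add0n orFb.
Qed.

(** * Greedy filling by intervals of indices *)

Section Intervals.
Variables (n : nat) (w : 'I_n -> nat) (thr : nat).
Hypothesis w_small : forall i, w i <= thr.

(** Take the largest [b] for which the interval still weighs at most [v]. If [b < n], adding the
    element [b] exceeds [v], and this element weighs at most [thr]. *)
Lemma fill_interval a v : a <= n ->
  exists b, [/\ a <= b <= n, \sum_(i < n | a <= i < b) w i <= v &
                b = n \/ v <= \sum_(i < n | a <= i < b) w i + thr].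
Proof.
move=> an; pose P b := (b <= n) && (\sum_(i < n | a <= i < b) w i <= v).
have exP : exists b, P b.
  exists a; rewrite /P an big_pred0 // => i; lia.
have bdP b : P b -> b <= n by move=> /andP[].
have /= := ex_maxnP exP bdP; case: ex_maxnP => b /andP[bn bv] bmax _.
have ab : a <= b by apply: bmax; rewrite /P an big_pred0 // => i; lia.
exists b; split=> //; first by rewrite ab.
case: (leqP n b) => [nb|ltbn]; [left; lia | right].
have := contra (bmax b.+1); rewrite ltnn => /(_ isT).
rewrite /P ltbn /= -ltnNge (bigD1 (Ordinal ltbn)) /=; last by rewrite ab /=.
rewrite (eq_bigl (fun i : 'I_n => a <= i < b)).
  by move=> H; have := w_small (Ordinal ltbn); lia.
by move=> i; rewrite -val_eqE /=; lia.
Qed.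

(** The intervals are laid end to end, each starting where the previous one stopped. Either the
    elements run out ([e = n]), or every interval falls short of its target by at most [thr] and the
    deficits add up. *)
Lemma fill_intervals (T : eqType) (v : T -> nat) (s : seq T) : uniq s ->
  forall a0, a0 <= n ->
  exists (a b : T -> nat) (e : nat),
    [/\ a0 <= e <= n,
        forall x, x \in s ->
          [/\ a x <= n, b x <= n & \sum_(i < n | a x <= i < b x) w i <= v x],
        forall i, a0 <= i < e -> exists2 x, x \in s & a x <= i < b x &
        e = n \/ \sum_(x <- s) v x <= \sum_(i < n | a0 <= i < e) w i + size s * thr].
Proof.
elim: s => [_|x s IH /= /andP[xs us]] a0 a0n.
  exists (fun=> 0), (fun=> 0), a0; split=> //; first by rewrite leqnn.
    by move=> i; lia.
  by right; rewrite big_nil.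
have [b0 [/andP[a0b0 b0n] le_v full]] := fill_interval (v x) a0n.
have [a [b [e [/andP[b0e en] Hs Hcov Hfull]]]] := IH us b0 b0n.
exists (fun y => if y == x then a0 else a y), (fun y => if y == x then b0 else b y), e.
split; first by rewrite en andbT; exact: leq_trans b0e.
- move=> y; rewrite in_cons; case: eqP => [-> _ //|_ /= ys]; exact: Hs.
- move=> i /andP[a0i ie]; case: (ltnP i b0) => ib0.
    by exists x; rewrite ?mem_head // eqxx a0i.
  have [|y ys yi] := Hcov i; first by rewrite ib0.
  exists y; first by rewrite in_cons ys orbT.
  by case: eqP => // yx; rewrite -yx ys in xs.
case: Hfull => [->|Hfull]; first by left.
case: full => [b0E|full]; first by left; lia.
right; rewrite big_cons mulSn.
have -> : \sum_(i < n | a0 <= i < e) w i =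
          \sum_(i < n | a0 <= i < b0) w i + \sum_(i < n | b0 <= i < e) w i.
  rewrite (bigID (fun i : 'I_n => i < b0)) /=; congr (_ + _); apply: eq_bigl => i; lia.
lia.
Qed.

End Intervals.

(** Take the least [thr] with at most [h] larger elements. If it is [m.+1], minimality gives more
    than [h] elements of size at least [m.+1], whence the last bound; if it is 0, that bound is
    trivial. *)
Lemma threshold (I : finType) (z : I -> nat) (P : pred I) (h : nat) :
  exists thr, [/\ thr \in 0 :: [seq z i | i : I], #|[pred i | P i & thr < z i]| <= h &
                  h * thr <= \sum_(i | P i) z i].
Proof.
pose Q thr := #|[pred i | P i & thr < z i]| <= h.
have exQ : exists thr, Q thr.
  exists (\max_i z i); rewrite /Q eq_card0 // => i; rewrite inE /=.
  by rewrite ltnNge leq_bigmax andbF.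
case: (ex_minnP exQ) => thr Qt tmin; exists thr.
case: thr => [|m] in Qt tmin *; first by rewrite mem_head muln0.
have : ~~ Q m by apply: contraL (leqnn m.+1) => /tmin; rewrite -ltnNge.
rewrite /Q -ltnNge => hm; split=> //.
- rewrite in_cons /=; apply/mapP.
  (* If no element had size exactly [m.+1], as many would exceed [m] as [m.+1], contradicting
     minimality. *)
  suff /existsP[i /andP[Pi /eqP zi]] : [exists i, P i && (z i == m.+1)].
    by exists i; rewrite ?mem_enum.
  apply: contraLR hm => /existsPn no; rewrite -leqNgt; apply: leq_trans Qt.
  apply: subset_leq_card; apply/subsetP => i; rewrite !inE => /andP[Pi mz].
  by rewrite Pi /=; have := no i; rewrite Pi /=; lia.
apply: (@leq_trans (\sum_(i | P i && (m < z i)) m.+1)).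
  by rewrite sum_nat_const leq_mul2r ltnW ?orbT.
rewrite big_mkcondr /=; apply: leq_sum => i _; case: ifP => //.
Qed.

Lemma first_some_mem (T : eqType) (s : seq (option T)) y :
  first_some s = Some y -> Some y \in s.
Proof.
rewrite /first_some; suff H a : foldl (fun a y => if isSome a then a else y) a s = Some y ->
  a = Some y \/ Some y \in s by move/H => [].
elim: s a => [|x s IH] a /=; first by left.
by move/IH => []; [case: a => [a|] /= -> | rewrite in_cons => ->]; rewrite ?orbT ?mem_head; auto.
Qed.

Lemma first_someT (T : eqType) (s : seq (option T)) y :
  Some y \in s -> isSome (first_some s).
Proof.
rewrite /first_some; suff H a : isSome a || (Some y \in s) ->
  isSome (foldl (fun a y => if isSome a then a else y) a s) by move=> ys; apply: H.
elim: s a => [|x s IH] a /=; first by rewrite in_nil orbF.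
rewrite in_cons => H; apply: IH; case: a H => [a|] //=.
by case/predU1P => [<-|->]; rewrite ?orbT.
Qed.

(** * Schedules described by lists of rules *)

Section Rules.
Variable K : nat.
Implicit Types (g : seq (rule K)) (r : rule K) (x : item).

Lemma decide_some g x B : decide g x = Some B ->
  exists2 r, r \in g & matches r x && (r.2.1.2 == B).
Proof.
move/first_some_mem/mapP => [r rg]; case: ifP => // mr [->].
by exists r; rewrite ?mr /=.
Qed.

Lemma decide_match g x r : r \in g -> matches r x -> isSome (decide g x).
Proof.
move=> rg mr; apply: (@first_someT _ _ r.2.1.2).
by apply/mapP; exists r; rewrite ?mr.
Qed.

Lemma guessesP H (U : seq (rule K)) g :
  reflect (size g = H /\ {subset g <= U}) (g \in guesses H U).
Proof.
elim: H g => [|H IH] g /=.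
  rewrite mem_seq1; apply: (iffP eqP) => [-> //|[/size0nil]]; by [].
apply: (iffP allpairsP) => [[[r g'] /= [rU /IH[<- sub] ->]]|[]].
  by split=> // y; rewrite in_cons => /predU1P[->|/sub].
case: g => [//|r g] [sz sub]; exists (r, g); split=> //=.
  by apply: sub; rewrite mem_head.
by apply/IH; split=> // y yg; apply: sub; rewrite in_cons yg orbT.
Qed.

Lemma load_candidate g (s : seq item) (j : 'I_K) :
  load (candidate s g) j.+1 =
  \sum_(x <- s) if j \in odflt set0 (decide g x) then x.2.1 else 0.
Proof.
rewrite /load big_map; apply: eq_bigr => x _ /=.
by rewrite has_pred1 mem_numbers.
Qed.

Lemma profit_candidate g (s : seq item) :
  profit (candidate s g) =
  \sum_(x <- s) if isSome (decide g x) then x.2.1 * x.2.2.1 else 0.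
Proof. by rewrite /profit big_map. Qed.

(** Each item placed in slot [j] is charged to the rule that decided it; other matching rules only
    increase the right-hand side. *)
Lemma load_le_rules g (s : seq item) (j : 'I_K) :
  load (candidate s g) j.+1 <=
  \sum_(r <- g) \sum_(x <- s) if matches r x && (j \in r.2.1.2) then x.2.1 else 0.
Proof.
rewrite load_candidate exchange_big /=; apply: leq_sum => x _.
case E : (decide g x) => [B|] /=; last by rewrite in_set0.
have [r rg /andP[mr /eqP rB]] := decide_some E.
apply: leq_trans (leq_sum_mem _ rg); by rewrite mr rB.
Qed.

Lemma keys_uniq : uniq (keys K).
Proof.
apply: allpairs_uniq; rewrite ?iota_uniq //; last by move=> [? ?] [? ?].
by apply: allpairs_uniq; rewrite ?iota_uniq // => [[? ?] [? ?]].
Qed.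

Lemma key_slots_uniq t : uniq (key_slots K t).
Proof. by rewrite filter_uniq ?enum_uniq. Qed.

Lemma assignments_uniq : uniq (assignments K).
Proof.
apply: allpairs_uniq_dep; first exact: keys_uniq.
  by move=> t _; exact: key_slots_uniq.
by move=> [? ?] [? ?] _ _ [-> ->].
Qed.

Lemma mem_assignments t B :
  ((t, B) \in assignments K) =
  [&& t.1 <= K, t.2.1 <= K.+1, t.2.2 <= K & key_admits t B].
Proof.
have -> : ((t, B) \in assignments K) = (t \in keys K) && (B \in key_slots K t).
  apply/allpairsPdep/andP => [[t' [B' [? ? [-> ->]]]]|[? ?]] //.
  by exists t, B; split.
rewrite mem_filter mem_enum andbT andbA andbA -[X in _ = X && _]andbA; congr (_ && _).
case: t => w [r d]; apply/allpairsP/and3P => [[[w' [r' d']] [wK rdK [-> -> ->]]]|[wK rK dK]].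
  move: wK rdK; rewrite [_.1]/= [_.2]/= mem_iota => wK /allpairsP[[r'' d''] [rK dK [-> ->]]].
  by move: rK dK; rewrite [_.1]/= [_.2]/= !mem_iota /= => rK dK; split; lia.
exists (w, (r, d)); rewrite [_.1]/= [_.2]/=; split=> //.
  by rewrite mem_iota; move: wK => /=; lia.
apply/allpairsP; exists (r, d); rewrite [_.1]/= [_.2]/=; split=> //.
  by rewrite mem_iota; move: rK => /=; lia.
by rewrite mem_iota; move: dK => /=; lia.
Qed.

End Rules.

(** * Rounding a given schedule *)

Section Rounding.
Variables (K n h : nat) (z : 'I_n -> nat) (t : 'I_n -> key) (c : 'I_n -> decision K).
Hypothesis c_admissible : forall i B, c i = Some B -> (t i, B) \in assignments K.

Let pt_item (i : 'I_n) : item := (i : nat, (z i, t i)).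
Let s : seq item := [seq pt_item i | i <- enum 'I_n].

Let slots_of i := odflt set0 (c i).
Let weight i := z i * (t i).1.
Let opt := \sum_i if isSome (c i) then weight i else 0.
(** A positive frequency makes the size at most the weight, so [threshold] applied to these ads
    yields [h * thr <= opt]. *)
Let rel i := isSome (c i) && (0 < (t i).1).

Lemma sum_items (F : item -> nat) : \sum_(x <- s) F x = \sum_i F (pt_item i).
Proof. by rewrite big_map big_enum. Qed.

Lemma mem_rules a b q thr : a <= n -> b <= n -> q \in assignments K ->
  thr \in 0 :: [seq z i | i : 'I_n] -> ((a, b), (q, thr)) \in rules K s.
Proof.
move=> an bn qK thrz.
have idx m : m <= n -> m \in 0 :: [seq x.1.+1 | x <- s].
  case: m => [|m] mn; first by rewrite mem_head.
  rewrite in_cons -map_comp; apply/orP; right; apply/mapP.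
  by exists (Ordinal mn); rewrite ?mem_enum.
apply/allpairsP; exists ((a, b), (q, thr)); split=> //.
  by apply/allpairsP; exists (a, b); split=> //=; apply: idx.
apply/allpairsP; exists (q, thr); split=> //.
by rewrite -map_comp; exact: thrz.
Qed.

Section Threshold.
Variable thr : nat.

Let small_weight (q : key) i := if (z i <= thr) && (t i == q) then z i else 0.
Let mass (q : key) (B : {set 'I_K}) :=
  \sum_i if [&& z i <= thr, t i == q & c i == Some B] then z i else 0.
Let large := [pred i | rel i & thr < z i].

(* The small ads of key [q] with index in [a q B, b q B) are repacked into [B],
   those with index at least [e q] are dropped. *)
Variables (a b : key -> {set 'I_K} -> nat) (e : key -> nat).
Hypothesis fill : forall q B, B \in key_slots K q ->
  [/\ a q B <= n, b q B <= n & \sum_(i < n | a q B <= i < b q B) small_weight q i <= mass q B].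
Hypothesis cover : forall q (i : 'I_n), i < e q ->
  exists2 B, B \in key_slots K q & a q B <= i < b q B.
Hypothesis full : forall q,
  \sum_(B <- key_slots K q) mass q B <=
  \sum_(i < n | i < e q) small_weight q i + size (key_slots K q) * thr.

(** The interval of length one singles out the ad [i], with its own size as threshold. *)
Let large_rule (i : 'I_n) : rule K := ((i : nat, i.+1), ((t i, slots_of i), z i)).
Let small_rule (q : key * {set 'I_K}) : rule K := ((a q.1 q.2, b q.1 q.2), (q, thr)).
(** Its empty interval matches nothing; it pads the guess to the fixed length when there are fewer
    than [h] large ads. *)
Let idle_rule : rule K := ((0, 0), (((0, (0, 0)), set0), 0)).
Let guess : seq (rule K) :=
  [seq large_rule i | i <- enum large] ++ nseq (h - #|large|) idle_rule ++
  [seq small_rule q | q <- assignments K].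

Lemma guess_in_guesses : #|large| <= h -> thr \in 0 :: [seq z i | i : 'I_n] ->
  guess \in guesses (h + size (assignments K)) (rules K s).
Proof.
move=> large_h thrz.
have sz_guess : size guess = h + size (assignments K).
  rewrite /guess; move: (assignments K) => A.
  by rewrite !size_cat !size_map size_nseq -cardE addnA subnKC.
apply/guessesP; split; first exact: sz_guess.
move: (rules K s) mem_rules => U mem_U.
move=> r; rewrite !mem_cat => /or3P[/mapP[i iL ->]|/nseqP[-> _]|/mapP[[q B] qK ->]].
- move: iL; rewrite mem_enum => /andP[/andP[ci _] _].
  rewrite /large_rule; apply: mem_U; rewrite ?ltn_ord 1?ltnW //.
    by apply: c_admissible; rewrite /slots_of; case: (c i) ci.
  by rewrite in_cons; apply/orP; right; apply/mapP; exists i; rewrite ?mem_enum.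
- rewrite /idle_rule; apply: mem_U; rewrite ?mem_head //.
  by rewrite mem_assignments /= /key_admits cards0 eqxx; apply/forall_inP => j; rewrite in_set0.
have qs : B \in key_slots K q.
  move: qK => /allpairsPdep[q' [B' [_ ? [-> ->]]]]; done.
by have [? ? _] := fill qs; rewrite /small_rule; apply: mem_U.
Qed.

(** After exchanging the sums, a chosen small ad counts for exactly one pair, [(t i, B)], which
    occurs once in [assignments]. [F] will be the indicator of a slot for loads and the frequency
    for profits. *)
Lemma sum_mass (F : key -> {set 'I_K} -> nat) :
  \sum_(q <- assignments K) F q.1 q.2 * mass q.1 q.2 =
  \sum_(i | z i <= thr) if c i is Some B then F (t i) B * z i else 0.
Proof.
under eq_bigr do rewrite big_distrr /=.
rewrite exchange_big /= [RHS]big_mkcond /=; apply: eq_bigr => i _.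
case: leqP => zi /=; last by rewrite big1 // => q _; rewrite muln0.
case E: (c i) => [B|]; last by rewrite big1 // => q _; rewrite andbF muln0.
have := sum_uniq_pred1 (fun q => F q.1 q.2 * z i) (t i, B) (assignments_uniq K).
rewrite (c_admissible E) /= => <-; apply: eq_bigr => -[q B'] _ /=.
have -> : ((q, B') == (t i, B)) = (t i == q) && (Some B == Some B').
  by apply/eqP/andP => [[-> ->]|[/eqP <- /eqP [->]]].
by case: ifP => //; rewrite muln0.
Qed.

(** A large rule catches only its own ad, which stays where it was. A small rule puts into its set
    at most the mass that the given schedule has there. *)
Lemma load_guess (j : 'I_K) :
  load (candidate s guess) j.+1 <= \sum_i if j \in slots_of i then z i else 0.
Proof.
apply: leq_trans (load_le_rules _ _ _) _.
rewrite !big_cat /= big_map big_enum /=.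
rewrite [leqRHS](bigID (fun i => z i <= thr)) /= [leqRHS]addnC; apply: leq_add.
  rewrite big_mkcond [leqRHS]big_mkcond /=; apply: leq_sum => i _.
  rewrite inE /=; case: ifP => // /andP[_ thrz].
  rewrite -ltnNge thrz sum_items (bigD1 i) //= /matches /= !leqnn eqxx /=.
  rewrite big1 ?addn0 // => i' i'i; rewrite /matches /=.
  case: ifP => // /andP[/and4P[ii' i'i1 _ _] _].
  by case/eqP: i'i; apply: val_inj => /=; lia.
rewrite big1_seq ?add0n; last first.
  move=> r; rewrite mem_nseq => /andP[_ /andP[_ /eqP->]].
  by apply: big1 => x _; rewrite /matches /idle_rule /= ?andbF.
rewrite big_map.
apply: (@leq_trans (\sum_(q <- assignments K) (j \in q.2) * mass q.1 q.2)).
  rewrite big_seq [leqRHS]big_seq; apply: leq_sum => -[q B] qK /=.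
  have qs : B \in key_slots K q.
    by move: qK => /allpairsPdep[q' [B' [_ ? [-> ->]]]].
  have [_ _ le_mass] := fill qs.
  rewrite sum_items; case: (j \in B); last first.
    by rewrite big1 // => i _; rewrite andbF.
  rewrite mul1n; apply: leq_trans le_mass; rewrite [leqRHS]big_mkcond /=.
  apply: leq_sum => i _; rewrite andbT /matches /= /small_weight (eq_sym q).
  by case: (a q B <= i); case: (i < b q B); case: (z i <= thr).
rewrite (sum_mass (fun _ B => (j \in B) : nat)); apply: leq_sum => i _.
by rewrite /slots_of; case: (c i) => [B|] //=; case: (j \in B); rewrite ?mul1n.
Qed.

(** Large ads of positive frequency are all kept. For every key the dropped small ads cost at most
    [thr] per set of slots in total size, and this is multiplied by a frequency of at most [K]. *)
Lemma profit_guess :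
  opt <= profit (candidate s guess) + K * size (assignments K) * thr.
Proof.
rewrite profit_candidate sum_items /opt.
rewrite (bigID (fun i => z i <= thr)) [X in _ <= X + _](bigID (fun i => z i <= thr)) /=.
rewrite addnAC; apply: leq_add; last first.
  apply: leq_sum => i; rewrite -ltnNge => zi.
  case ci: (isSome (c i)) => //; case: (posnP (t i).1) => [w0|w1].
    by rewrite /weight w0 muln0.
  rewrite (@decide_match _ _ _ (large_rule i)) //.
    by rewrite mem_cat map_f // mem_enum inE /= /rel ci w1.
  by rewrite /matches /= !leqnn eqxx.
have -> : \sum_(i | z i <= thr) (if isSome (c i) then weight i else 0) =
    \sum_(q <- assignments K) q.1.1 * mass q.1 q.2.
  rewrite (sum_mass (fun q _ => q.1)); apply: eq_bigr => i _.
  by case: (c i) => //= B; rewrite /weight mulnC.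
rewrite (size_allpairs_dep pair) /assignments big_allpairs_dep.
(* Per key: the weight of the small ads that are repacked, plus the loss allowed by [full]. *)
apply: (@leq_trans (\sum_(q <- keys K)
   (\sum_(i < n) (if i < e q then q.1 * small_weight q i else 0) +
    K * size (key_slots K q) * thr))).
  rewrite big_seq [leqRHS]big_seq; apply: leq_sum => q qK.
  rewrite -big_mkcond -!big_distrr /= -mulnA.
  apply: leq_trans (leq_mul (leqnn q.1) (full q)) _.
  rewrite mulnDr leq_add2l leq_mul2r; apply/orP; right.
  by move: qK => /allpairsP[[w rd] [wK _ ->]]; move: wK; rewrite mem_iota /=; lia.
rewrite big_split; apply: leq_add; last first.
  rewrite sumnE big_map; move: (keys K) => ks.
  by rewrite -big_distrl leq_mul2r -big_distrr leqnn orbT.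
rewrite exchange_big [leqRHS]big_mkcond /=; apply: leq_sum => i _.
(* For a fixed ad only its own key contributes to the sum over keys. *)
apply: (@leq_trans (\sum_(q <- keys K) if q == t i then
    (if (i < e q) && (z i <= thr) then q.1 * z i else 0) else 0)).
  apply: leq_sum => q _; rewrite /small_weight (eq_sym q).
  by case: (i < e q); case: (z i <= thr); case: eqP; rewrite ?muln0.
rewrite sum_uniq_pred1 ?keys_uniq //; case: ifP => // tK.
case: ifP => // /andP[ie zi]; rewrite zi.
have [B Bs abi] := cover ie.
rewrite (@decide_match _ _ _ (small_rule (t i, B))); first by rewrite mulnC.
  rewrite !mem_cat map_f ?orbT //; apply/allpairsPdep; by exists (t i), B; split.
by move: abi => /andP[ai ib]; rewrite /matches /= ai ib zi eqxx.
Qed.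

End Threshold.

(** The loss is at most a constant times [thr]. Multiplying by [h] and using [h * thr <= opt] makes
    it relative to [opt] without any division. *)
Lemma rounding : exists g,
  [/\ g \in guesses (h + size (assignments K)) (rules K s),
      forall j : 'I_K,
        load (candidate s g) j.+1 <= \sum_i if j \in slots_of i then z i else 0 &
      h * opt <= h * profit (candidate s g) + K * size (assignments K) * opt].
Proof.
have [thr [thrz large_h h_thr]] := threshold z rel h.
pose w q i := if (z i <= thr) && (t i == q) then z i else 0.
pose v q B := \sum_i if [&& z i <= thr, t i == q & c i == Some B] then z i else 0.
have w_small q i : w q i <= thr by rewrite /w; case: ifP => // /andP[].
(* Each key is filled separately: [w q] vanishes on all other keys, and a rule ignores them, so
   intervals for different keys may overlap. *)
have /choice [f Hf] : forall q, exists f : ({set 'I_K} -> nat) * ({set 'I_K} -> nat) * nat,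
  [/\ forall B, B \in key_slots K q ->
        [/\ f.1.1 B <= n, f.1.2 B <= n &
            \sum_(i < n | f.1.1 B <= i < f.1.2 B) w q i <= v q B],
      forall i : 'I_n, i < f.2 -> exists2 B, B \in key_slots K q & f.1.1 B <= i < f.1.2 B &
      \sum_(B <- key_slots K q) v q B <=
      \sum_(i < n | i < f.2) w q i + size (key_slots K q) * thr].
  move=> q.
  have [a [b [e [_ Hs Hcov Hfull]]]] :=
    fill_intervals (w_small q) (v q) (key_slots_uniq K q) (leq0n n).
  exists (a, b, e); split=> //=; first by move=> i ie; apply: Hcov.
  (* If the indices run out, all small ads of the key are packed, and the masses total at most their
     sizes because an ad has only one set of slots. *)
  case: Hfull => [->|//]; apply: leq_trans (leq_addr _ _).
  rewrite exchange_big [leqRHS]big_mkcond /=; apply: leq_sum => i _; rewrite ltn_ord /w.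
  case: ifP => [/andP[zi ti]|/negbT]; last first.
    by rewrite negb_and => /orP[] /negPf no; rewrite big1 // => B _; rewrite no ?andbF.
  rewrite zi ti /=; case E: (c i) => [B|]; last by rewrite big1.
  rewrite (eq_bigr (fun B' => if B' == B then z i else 0)); last first.
    by move=> B' _; rewrite eq_sym.
  by rewrite sum_uniq_pred1 ?key_slots_uniq //; case: ifP.
have Hfill q := let: And3 H _ _ := Hf q in H.
have Hcover q := let: And3 _ H _ := Hf q in H.
have Hfull q := let: And3 _ _ H := Hf q in H.
eexists; split.
- exact: (guess_in_guesses Hfill large_h thrz).
- exact: (load_guess Hfill).
have Hp := profit_guess Hcover Hfull.
apply: leq_trans (leq_mul (leqnn h) Hp) _.
rewrite mulnDr leq_add2l mulnCA leq_mul2l; apply/orP; right.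
apply: leq_trans h_thr _; rewrite /opt big_mkcond /=; apply: leq_sum => i _.
rewrite /rel /weight; case: (isSome (c i)) => //=.
by case: (t i).1 => // w0; rewrite mulnS leq_addr.
Qed.

End Rounding.

(** * Correctness of the algorithm *)

Lemma best_spec K y0 (s : seq (bool * (nat * seq (decision K)))) :
  [/\ best y0 s = y0 \/ exists2 y, y \in s & y.1 /\ best y0 s = y.2,
      y0.1 <= (best y0 s).1 &
      forall y, y \in s -> y.1 -> y.2.1 <= (best y0 s).1].
Proof.
elim: s y0 => [|x s IH] y0 /=; first by split=> //; left.
have [Hin Hle Hmax] := IH (if x.1 && (y0.1 <= x.2.1) then x.2 else y0).
split.
- case: Hin => [->|[y ys [y1 ->]]].
    case: ifP => [/andP[x1 _]|_]; last by left.
    by right; exists x; rewrite ?mem_head.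
  by right; exists y; rewrite // in_cons ys orbT.
- by apply: leq_trans Hle; case: ifP => // /andP[].
move=> y; rewrite in_cons => /predU1P[->|ys] y1; last exact: Hmax.
by apply: leq_trans Hle; rewrite y1 /=; case: (leqP y0.1 x.2.1) => // /ltnW.
Qed.

Import Order.TTheory GRing.Theory Num.Theory.

Section Correctness.
Variables (K n : nat) (A : n.-tuple ad).
Hypothesis A_valid : valid_instance K A.

Let D := common_den A.
Let z (i : 'I_n) := scaled_size D (tnth A i).
Let t (i : 'I_n) := key_of (tnth A i).
Let x (i : 'I_n) : item := (i : nat, (z i, t i)).

Lemma items_tuple : items A = [seq x i | i <- enum 'I_n].
Proof.
have sizes : [seq (scaled_size D a, key_of a) | a <- A] = [seq (z i, t i) | i <- enum 'I_n].
  by rewrite -[in LHS](map_tnth_enum A) -map_comp.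
rewrite /items /indexed size_map size_tuple -/D sizes -val_enum_ord.
by elim: (enum 'I_n) => //= i s ->.
Qed.

Lemma common_den_gt0 : 0 < D.
Proof.
rewrite /D /common_den prodn_gt0 // => a.
by rewrite /size_den absz_gt0 denq_neq0.
Qed.

(** The division in [scaled_size] is exact since the denominator is a factor of [D], and the
    numerator equals its absolute value since the size is positive. *)
Lemma scaled_sizeE i : ((z i)%:R = ad_size (tnth A i) * D%:R :> rat)%R.
Proof.
have /and5P[s0 _ _ _ _] := forallP A_valid i.
set a := tnth A i in s0 *.
have dD : size_den a %| D.
  by rewrite /D /common_den big_tuple (bigD1 i) //= dvdn_mulr.
have numE : ((size_num a)%:R = ad_size a * (size_den a)%:R :> rat)%R.
  rewrite /size_num /size_den !natr_absz !gtr0_norm ?denq_gt0 ?numq_gt0 //.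
  by rewrite -[X in _ = (X * _)%R]divq_num_den divfK // intr_eq0 denq_neq0.
by rewrite /z -/a /scaled_size -[in RHS](divnK dD) !natrM numE [X in _ = (_ * X)%R]mulrC mulrA.
Qed.

Definition scaled_profit (S : schedule K n) : nat :=
  \sum_i if isSome (S i) then z i * (t i).1 else 0.

Definition scaled_load (S : schedule K n) (j : 'I_K) : nat :=
  \sum_i if j \in odflt set0 (S i) then z i else 0.

Lemma scaled_profitE S : ((scaled_profit S)%:R = fullness A S * D%:R :> rat)%R.
Proof.
rewrite /fullness mulr_suml natr_sum [RHS]big_mkcond /=; apply: eq_bigr => i _.
rewrite inE; case: (S i) => [B|] //=.
by rewrite natrM scaled_sizeE mulrAC.
Qed.

Lemma scaled_load_le S (j : 'I_K) :
  (scaled_load S j <= D) =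
  (\sum_(i in chosen S | j \in slots S i) ad_size (tnth A i) <= 1)%R.
Proof.
have D0 : (0 < D%:R :> rat)%R by rewrite ltr0n common_den_gt0.
rewrite -(ler_nat rat) -[RHS](ler_pM2r D0) mul1r mulr_suml natr_sum.
congr (_ <= _)%R; rewrite [RHS]big_mkcond /=; apply: eq_bigr => i _.
rewrite inE /slots; case: (S i) => [B|] /=; last by rewrite in_set0.
by case: ifP => // _; rewrite scaled_sizeE.
Qed.

Lemma feasibleP (S : schedule K n) :
  reflect ((forall i B, S i = Some B -> key_admits (t i) B) /\
           (forall j, scaled_load S j <= D))
          (feasible A S).
Proof.
apply: (iffP andP) => [[/forall_inP Sk /forallP Sl]|[Sk Sl]]; split.
- move=> i B SiB; have := Sk i; rewrite inE /slots SiB => /(_ isT) /andP[cB jB].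
  by rewrite /key_admits cB.
- by move=> j; rewrite scaled_load_le.
- apply/forall_inP => i; rewrite inE /slots; case SiB: (S i) => [B|] //= _.
  exact: Sk SiB.
by apply/forallP => j; rewrite -scaled_load_le.
Qed.

Lemma valid_key_bounds i : [/\ (t i).1 <= K, (t i).2.1 <= K.+1 & (t i).2.2 <= K].
Proof. by have /and5P[_ _ r1 dK wd] := forallP A_valid i; split=> /=; lia. Qed.

(** The winner is the empty schedule or a guess that passed [fits], and both are feasible; a guess
    that respects the capacities has taken part in the comparison. *)
Lemma solve_correct H : exists S : schedule K n,
  [/\ solve K H A = [seq S i | i <- enum 'I_n],
      feasible A S &
      forall g, g \in guesses H (rules K (items A)) ->
        (forall j : 'I_K, load (candidate (items A) g) j.+1 <= D) ->
        profit (candidate (items A) g) <= scaled_profit S].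
Proof.
rewrite /solve; set s := items A.
have [Hin _ Hmax] := best_spec (0, [seq None | x <- s])
  [seq (fits D (candidate s g), (profit (candidate s g), [seq y.2 | y <- candidate s g]))
    | g <- guesses H (rules K s)].
set y := best _ _ in Hin Hmax *.
suff [S [Sy Sf Sp]] : exists S : schedule K n,
    [/\ y.2 = [seq S i | i <- enum 'I_n], feasible A S & y.1 <= scaled_profit S].
  exists S; split=> // g gU gl; apply: leq_trans Sp.
  apply: (Hmax (fits D (candidate s g), (profit (candidate s g),
    [seq y.2 | y <- candidate s g]))); first exact: map_f.
  by apply/allP => _ /mapP[j _ ->]; exact: gl.
case: Hin => [->|[_ /mapP[g gU ->] [/allP /= fit ->]]] /=.
  exists [ffun=> None]; split=> //.
    rewrite /s items_tuple -map_comp; apply: eq_map => i /=; by rewrite ffunE.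
  apply/feasibleP; split=> [i B|j]; first by rewrite ffunE.
  by rewrite /scaled_load big1 // => i _; rewrite ffunE /= in_set0.
exists [ffun i => decide g (x i)]; split.
- rewrite /s items_tuple -!map_comp; apply: eq_map => i /=; by rewrite ffunE.
- apply/feasibleP; split=> [i B|j].
    (* The deciding rule has the key of the ad, and its pair comes from [assignments], so its set is
       admissible. *)
    rewrite ffunE => /decide_some[r rg /andP[/and4P[_ _ _ /eqP rt] /eqP <-]].
    rewrite -[t i]/((x i).2.2) -rt.
    have /guessesP[_ sub] := gU.
    have /allpairsP[[ab q] [_ qU rE]] := sub _ rg.
    have /allpairsP[[tB thr] [tBK _ qE]] := qU.
    move: tBK; rewrite rE qE /=; case: tB {qE} => t' B' /=.
    by rewrite mem_assignments => /and4P[].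
  have := fit j.+1; rewrite mem_numbers in_setT => /(_ isT).
  rewrite load_candidate /s items_tuple big_map big_enum /= => le_D.
  by apply: leq_trans le_D; apply: eq_leq; apply: eq_bigr => i _; rewrite ffunE.
rewrite profit_candidate /s items_tuple big_map big_enum /=.
by apply: eq_leq; apply: eq_bigr => i _; rewrite ffunE.
Qed.

(** Rounding [S'] gives a guess with loads no larger than those of [S'], hence within capacity, so
    the output is at least as good. *)
Lemma solve_approx h : exists S : schedule K n,
  [/\ solve K (h + size (assignments K)) A = [seq S i | i <- enum 'I_n],
      feasible A S &
      forall S' : schedule K n, feasible A S' ->
        h * scaled_profit S' <=
        h * scaled_profit S + K * size (assignments K) * scaled_profit S'].
Proof.
have [S [SE Sf Smax]] := solve_correct (h + size (assignments K)).
exists S; split=> // S' /feasibleP[S'k S'l].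
have adm i B : S' i = Some B -> (t i, B) \in assignments K.
  move=> SiB; rewrite mem_assignments (S'k _ _ SiB) andbT.
  by have [-> -> ->] := valid_key_bounds i.
have [g [gU gl gp]] := rounding h z adm.
apply: leq_trans gp _; rewrite leq_add2r leq_mul2l; apply/orP; right.
rewrite -items_tuple; apply: Smax; rewrite items_tuple // => j.
exact: leq_trans (gl j) (S'l j).
Qed.

End Correctness.

(** * The approximation scheme *)

Theorem theorem2 (R : realType) (K : nat) (eps : R) :
  (0 < eps)%R -> polytime_approximable K (1 - eps)%R.
Proof.
move=> eps0; set N := K * size (assignments K).
(* Then [N <= eps * h], so the loss [N * F'] in the inequality scaled by [h] is at most
   [eps * h * F']. *)
have [h hN] : exists h : nat, (N%:R / eps < h%:R :> R)%R.
  by exists (Num.bound (N%:R / eps)%R); apply: archi_boundP; rewrite divr_ge0 // ltW.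
have [p [c [d Hp]]] := pt_solve_ads K (h + size (assignments K)).
(* The factor [2 ^ d] absorbs the successor: a size is positive, so its successor is at most its
   double. *)
exists p, (c * 2 ^ d), d => n A A_valid.
have [S [SE Sf Smax]] := solve_approx A_valid h.
have [tm Hrun le_tm] := Hp A; exists S, tm; split=> //.
- move: Hrun; rewrite SE; congr runs; rewrite /enc /= /enc_seq -map_comp.
  by congr encode_list; apply: eq_map => i /=; case: (S i).
- apply: leq_trans le_tm _; apply: leq_trans (leq_addr _ _).
  rewrite -mulnA leq_mul2l -expnMn; apply/orP; right.
  case: (d) => // d'; rewrite leq_exp2r //.
  have : 0 < sz (tval A) by exact: vsize_gt0.
  by move=> sz0; rewrite mul2n -addnn -addn1; exact: leq_add sz0.
have D0 : (0 < (common_den A)%:R :> rat)%R by rewrite ltr0n common_den_gt0.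
have full_ge0 (S' : schedule K n) : (0 <= fullness A S')%R.
  by rewrite -(ler_pM2r D0) mul0r -scaled_profitE // ler0n.
have h0 : (0 < h%:R :> R)%R.
  by apply: le_lt_trans hN; rewrite divr_ge0 // ltW.
(* The property holds for the default 0 as fullness is nonnegative, and passes to a maximum, which
   is one of its two arguments, whatever the sign of [1 - eps]. *)
apply: (big_ind (fun v => (1 - eps) * ratr v <= ratr (fullness A S))%R).
- by rewrite rmorph0 mulr0 ler0q.
- by move=> u v Hu Hv; case: (leP u v).
move=> S' /Smax le_S'.
have le_rat : (h%:R * fullness A S' <= h%:R * fullness A S + N%:R * fullness A S')%R.
  move: le_S'; rewrite -(ler_nat rat) natrD -/N !natrM !(scaled_profitE A_valid) !mulrA.
  by rewrite -mulrDl ler_pM2r // -natrM.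
have : (ratr (h%:R * fullness A S') <= ratr (h%:R * fullness A S + N%:R * fullness A S') :> R)%R.
  by rewrite ler_rat.
rewrite rmorphD !rmorphM /= !ratr_nat.
have F'0 : (0 <= ratr (fullness A S') :> R)%R by rewrite ler0q.
move: (ratr (fullness A S')) (ratr (fullness A S)) F'0 => F' F F'0 le_R.
rewrite -(ler_pM2l h0) mulrA mulrBr mulr1 mulrBl lerBlDr; apply: le_trans le_R _.
rewrite lerD2l ler_wpM2r //.
by rewrite -natrM ltW // -ltr_pdivrMr.
Qed.
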